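(* Let $V$ be a finite dimensional real vector space and let $A \leq \mathrm{Aff}(V)$ be a Zariski-closed subgroup acting transitively on $V$. Let $\Gamma$ be a finitely generated torsionfree nilpotent group and let $\Delta$ be a finite, effective extension of $\Gamma$ (with $\Gamma$ normal in $\Delta$), $F = \Delta/\Gamma$. Then restriction of homomorphisms from $\Delta$ to $\Gamma$ induces a continuous bijection $$\bar{r}_{\Gamma}: \mathcal{D}_c(\Delta,A) \longrightarrow \mathcal{D}_c(\Gamma,A)^F .$$
   Context: A subgroup of $\mathrm{Aff}(V) = V\rtimes \mathrm{GL}(V)$ is an affine crystallographic group if it acts properly discontinuously on $V$ with compact quotient. For a finitely generated group $G$, $\mathrm{Hom}_c(G,A)$ is the set of injective homomorphisms $\rho: G \to A$ such that $\rho(G)$ is an affine crystallographic group, with the topology induced from $\mathrm{Hom}(G,A) \subset A^G$ (product topology, $A$ carrying its Lie group topology), and $\mathcal{D}_c(G,A) = \mathrm{Hom}_c(G,A)/A$ is the quotient by conjugation, with the quotient topology. $\mathrm{Aut}(\Gamma)$ acts on $\mathrm{Hom}_c(\Gamma,A)$ by $\rho \mapsto \rho\circ\phi^{-1}$, inducing an action of $\mathrm{Out}(\Gamma)$ on $\mathcal{D}_c(\Gamma,A)$. A finite effective extension of $\Gamma$ is a group $\Delta$ containing $\Gamma$ as a normal subgroup of finite index such that the homomorphism $\beta: F=\Delta/\Gamma \to \mathrm{Out}(\Gamma)$ induced by conjugation is injective. $F$ acts on $\mathcal{D}_c(\Gamma,A)$ via $\beta$, and $\mathcal{D}_c(\Gamma,A)^F$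 is the set of fixed points with the subspace topology. The restriction map $\mathrm{Hom}_c(\Delta,A)\to\mathrm{Hom}_c(\Gamma,A)$ induces $\bar r_\Gamma$, whose image lies in $\mathcal{D}_c(\Gamma,A)^F$. *)

(* Defs.v *)
From HB Require Import structures.
From mathcomp Require Import all_boot all_order all_algebra generic_quotient.
From mathcomp Require Import all_classical all_reals all_analysis.
From mathcomp Require mpoly.

Set Implicit Arguments.
Unset Strict Implicit.
Unset Printing Implicit Defensive.

Import Order.TTheory GRing.Theory Num.Theory.
Import numFieldNormedType.Exports.

Local Open Scope classical_set_scope.
Local Open Scope quotient_scope.
Local Open Scope ring_scope.

(* Every quotient below (orbit spaces, conjugacy classes, cosets) is taken by
   the relation f x = f y, where f sends x to its orbit, class or coset. *)
Section FibreQuotient.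
Variables (T : choiceType) (U : Type) (f : T -> U).

Definition fibre_rel : rel T := fun x y => `[< f x = f y >].

Lemma fibre_rel_refl : reflexive fibre_rel.
Proof. by move=> x; apply/asboolP. Qed.

Lemma fibre_rel_sym : symmetric fibre_rel.
Proof. by move=> x y; apply/asboolP/asboolP. Qed.

Lemma fibre_rel_trans : transitive fibre_rel.
Proof. by move=> y x z /asboolP xy /asboolP yz; apply/asboolP; rewrite xy. Qed.

Canonical fibre_equiv :=
  EquivRel fibre_rel fibre_rel_refl fibre_rel_sym fibre_rel_trans.

Definition fibre_quot := {eq_quot fibre_rel}.

HB.instance Definition _ := Choice.on fibre_quot.
HB.instance Definition _ := EqQuotient.on fibre_quot.

Lemma pi_fibre (x y : T) :
  \pi_fibre_quot x = \pi_fibre_quot y <-> f x = f y.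
Proof. by split=> [/eqmodP/asboolP|xy] //; apply/eqmodP/asboolP. Qed.

Lemma repr_fibre (x : T) : f (repr (\pi_fibre_quot x)) = f x.
Proof. by apply/pi_fibre; rewrite reprK. Qed.

End FibreQuotient.

Section Groups.
Local Open Scope group_scope.
Implicit Types G : groupType.

Definition is_subgroup G (H : set G) : Prop := group_closed [in H].

Lemma is_subgroup1 G (H : set G) : is_subgroup H -> H 1.
Proof. by case=> + _; rewrite inE. Qed.

Lemma is_subgroupV G (H : set G) x : is_subgroup H -> H x -> H x^-1.
Proof.
by move=> /group_closedV/(_ x); rewrite !inE => + Hx; apply.
Qed.

Lemma is_subgroupM G (H : set G) x y : is_subgroup H -> H x -> H y -> H (x * y).
Proof.
by move=> /group_closedM/(_ x y); rewrite !inE => + Hx Hy; apply.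
Qed.

Definition generated G (X : set G) : set G :=
  \bigcap_(H in [set H | is_subgroup H /\ X `<=` H]) H.

Definition finitely_generated G : Prop :=
  exists2 X : set G, finite_set X & generated X = [set: G].

Definition torsionfree G : Prop :=
  forall (x : G) (n : nat), (0 < n)%N -> x ^+ n = 1 -> x = 1.

Fixpoint lower_central G (n : nat) : set G :=
  if n is m.+1 then
    generated [set [~ x, y] | x in @lower_central G m & y in [set: G]]
  else [set: G].

Definition nilpotent_group G : Prop :=
  exists n, lower_central n = [set (1 : G)].

Definition cosets G (N : set G) :=
  fibre_quot (fun x : G => [set x * y | y in N]).

Definition coset_class G (N : set G) (x : G) : cosets N := \pi_(cosets N) x.

(* An automorphism is stored together with its (unique) inverse map. *)
Definition aut_pred G : pred ((G -> G) * (G -> G)) := fun p =>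
  `[< [/\ {morph p.1 : x y / x * y}, cancel p.1 p.2 & cancel p.2 p.1] >].

Inductive aut G := Aut p of @aut_pred G p.

Definition aut_val G (phi : aut G) := let: Aut p _ := phi in p.

HB.instance Definition _ G := [isSub of aut G for @aut_val G].
HB.instance Definition _ G := [Choice of aut G by <:].

Definition aut_fun G (phi : aut G) : G -> G := (aut_val phi).1.
Coercion aut_fun : aut >-> Funclass.
Definition aut_inv_fun G (phi : aut G) : G -> G := (aut_val phi).2.

Lemma autM G (phi : aut G) : {morph phi : x y / x * y}.
Proof. by case: phi => p pP; have /asboolP[] := pP. Qed.

Lemma autK G (phi : aut G) : cancel phi (aut_inv_fun phi).
Proof. by case: phi => p pP; have /asboolP[] := pP. Qed.

Lemma autVK G (phi : aut G) : cancel (aut_inv_fun phi) phi.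
Proof. by case: phi => p pP; have /asboolP[] := pP. Qed.

Lemma autP G (phi psi : aut G) : phi =1 psi -> phi = psi.
Proof.
move=> e; apply/val_inj/eqP; rewrite -pair_eqE; apply/andP; split; apply/eqP.
  exact/funext.
apply/funext => x; apply: (can_inj (autK phi)).
by rewrite [in RHS]e (autVK phi) (autVK psi).
Qed.

Lemma aut_one_subproof G : @aut_pred G (id, id).
Proof. exact/asboolP. Qed.

Lemma aut_mul_subproof G (phi psi : aut G) :
  @aut_pred G (phi \o psi, aut_inv_fun psi \o aut_inv_fun phi).
Proof.
apply/asboolP; split=> /= [x y|x|x] /=; first by rewrite !autM.
  by rewrite !autK.
by rewrite !autVK.
Qed.

Lemma aut_inv_subproof G (phi : aut G) :
  @aut_pred G (aut_inv_fun phi, phi : G -> G).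
Proof.
apply/asboolP; split=> /= [x y||]; [|exact: autVK|exact: autK].
by apply: (can_inj (autK phi)); rewrite autM !autVK.
Qed.

Definition aut_one G := Aut (aut_one_subproof G).
Definition aut_mul G (phi psi : aut G) := Aut (aut_mul_subproof phi psi).
Definition aut_inv G (phi : aut G) := Aut (aut_inv_subproof phi).

Lemma aut_mulA G : associative (@aut_mul G).
Proof. by move=> ? ? ?; exact: autP. Qed.
Lemma aut_mul1 G : left_id (@aut_one G) (@aut_mul G).
Proof. by move=> ?; exact: autP. Qed.
Lemma aut_1mul G : right_id (@aut_one G) (@aut_mul G).
Proof. by move=> ?; exact: autP. Qed.
Lemma aut_mulV G : left_inverse (@aut_one G) (@aut_inv G) (@aut_mul G).
Proof. by move=> phi; apply: autP => x; exact: autK. Qed.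
Lemma aut_Vmul G : right_inverse (@aut_one G) (@aut_inv G) (@aut_mul G).
Proof. by move=> phi; apply: autP => x; exact: autVK. Qed.

HB.instance Definition _ G := isGroup.Build (aut G)
  (@aut_mulA G) (@aut_mul1 G) (@aut_1mul G) (@aut_mulV G) (@aut_Vmul G).

Lemma inner_subproof G (a : G) :
  @aut_pred G (fun x => x ^ a^-1, fun x => x ^ a).
Proof.
apply/asboolP; split=> /= [x y|x|x]; first exact: conjMg.
  exact: conjgKV.
exact: conjgK.
Qed.

(* x ^ a^-1 = a * x * a^-1 *)
Definition inner G (a : G) : aut G := Aut (inner_subproof a).

Definition Inn G : set (aut G) := range (@inner G).

Definition Out G := cosets (@Inn G).

Definition out_of G (phi : aut G) : Out G := coset_class (@Inn G) phi.

Definition normal_in G (S : pred G) : Prop :=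
  forall x y : G, x \in S -> x ^ y \in S.

Section ConjugationAut.
Variables (G : groupType) (S : pred G) (H : subGroupType S) (nS : normal_in S).

Definition conj_fun (d : G) (x : H) : H := Sub (val x ^ d) (nS d (valP x)).

Lemma val_conj_fun d x : val (conj_fun d x) = val x ^ d.
Proof. exact: SubK. Qed.

Lemma conj_aut_subproof d : @aut_pred H (conj_fun d^-1, conj_fun d).
Proof.
apply/asboolP; split=> /= [x y|x|x]; apply: val_inj.
- by rewrite valM !val_conj_fun valM conjMg.
- by rewrite !val_conj_fun conjgKV.
- by rewrite !val_conj_fun conjgK.
Qed.

Definition conj_aut (d : G) : aut H := Aut (conj_aut_subproof d).

Lemma val_conj_aut d x : val (conj_aut d x) = d * val x * d^-1.
Proof. by rewrite val_conj_fun conjgE invgK mulgA. Qed.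

Definition beta (q : cosets [set` S]) : Out H := out_of (conj_aut (repr q)).

Lemma betaE d : beta (coset_class [set` S] d) = out_of (conj_aut d).
Proof.
set q := coset_class _ d.
have e : [set repr q * y | y in [set` S]] = [set d * y | y in [set` S]].
  exact: (repr_fibre (fun x : G => [set x * y | y in [set` S]])).
have [s Ss rs] : [set d * y | y in [set` S]] (repr q).
  rewrite -e; exists 1; last by rewrite mulg1.
  by have := valP (1 : H); rewrite val1.
have k : conj_aut (repr q) = conj_aut d * inner (Sub s Ss : H).
  apply: autP => x; apply: val_inj.
  have -> : (conj_aut d * inner (Sub s Ss : H)) x =
            conj_aut d (x ^ (Sub s Ss : H)^-1) by [].
  have vV (y : H) : val y^-1 = (val y)^-1.
    by apply: (mulgI (val y)); rewrite -valM !mulgV val1.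
  rewrite !val_conj_aut -rs conjgE invgK !valM vV SubK invgM.
  by rewrite !mulgA.
apply/pi_fibre; rewrite {}k; apply/seteqP; split=> _ [_ [a _ <-] <-].
  exists (inner (Sub s Ss) * inner a); last by rewrite mulgA.
  exists (Sub s Ss * a) => //.
  by apply: autP => x /=; rewrite /aut_fun /= invgM conjgM.
exists (inner ((Sub s Ss)^-1 * a)); first by exists ((Sub s Ss)^-1 * a).
rewrite -mulgA; congr (_ * _); apply: autP => x.
have -> : (inner (Sub s Ss : H) * inner ((Sub s Ss)^-1 * a)) x =
          (x ^ ((Sub s Ss)^-1 * a)^-1) ^ (Sub s Ss : H)^-1 by [].
by rewrite -conjgM -invgM mulVKg.
Qed.

End ConjugationAut.

End Groups.

(* Aff V = V x| GL V; the element (v, f) acts on V by x |-> v + f x. *)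
Section AffineGroup.
Variables (R : realType) (V : vectType R).

Inductive Aff := MkAff (p : V * 'End(V)) of (lker p.2 == 0)%VS.

Definition aff_val (g : Aff) := let: MkAff p _ := g in p.

HB.instance Definition _ := [isSub of Aff for aff_val].
HB.instance Definition _ := [Choice of Aff by <:].

Definition aff_trans (g : Aff) : V := (aff_val g).1.
Definition aff_lin (g : Aff) : 'End(V) := (aff_val g).2.
Definition aff_act (g : Aff) (x : V) : V := aff_trans g + aff_lin g x.

Lemma aff_linP g : (lker (aff_lin g) == 0)%VS. Proof. by case: g. Qed.

Lemma aff_eq g h :
  aff_trans g = aff_trans h -> aff_lin g = aff_lin h -> g = h.
Proof.
by move=> t l; apply: val_inj; apply/eqP; rewrite -pair_eqE; apply/andP; split;
  apply/eqP.
Qed.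

Lemma aff_one_subproof : (lker (\1%VF : 'End(V)) == 0)%VS.
Proof. by apply/lker0P => x y; rewrite !id_lfunE. Qed.

Lemma aff_mul_subproof g h : (lker (aff_lin g \o aff_lin h)%VF == 0)%VS.
Proof.
apply/lker0P => x y; rewrite !comp_lfunE.
by move=> /(lker0P (aff_linP g))/(lker0P (aff_linP h)).
Qed.

Lemma aff_inv_subproof g : (lker (aff_lin g)^-1%VF == 0)%VS.
Proof.
apply/lker0P => x y e.
by rewrite -(lker0_lfunVK (aff_linP g) x) e (lker0_lfunVK (aff_linP g)).
Qed.

Definition aff_one : Aff := @MkAff (0, \1%VF) aff_one_subproof.
Definition aff_mul (g h : Aff) : Aff :=
  @MkAff (aff_trans g + aff_lin g (aff_trans h), (aff_lin g \o aff_lin h)%VF)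
    (aff_mul_subproof g h).
Definition aff_inv (g : Aff) : Aff :=
  @MkAff (- (aff_lin g)^-1%VF (aff_trans g), (aff_lin g)^-1%VF)
    (aff_inv_subproof g).

Lemma aff_mulA : associative aff_mul.
Proof.
move=> g h k; apply: aff_eq; rewrite /aff_trans /aff_lin /=.
  by rewrite comp_lfunE linearD /= addrA.
by rewrite comp_lfunA.
Qed.

Lemma aff_1mul : left_id aff_one aff_mul.
Proof.
move=> g; apply: aff_eq; rewrite /aff_trans /aff_lin /=.
  by rewrite id_lfunE add0r.
by rewrite comp_lfun1l.
Qed.

Lemma aff_mul1 : right_id aff_one aff_mul.
Proof.
move=> g; apply: aff_eq; rewrite /aff_trans /aff_lin /=.
  by rewrite linear0 addr0.
by rewrite comp_lfun1r.
Qed.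

Lemma aff_mulV : left_inverse aff_one aff_inv aff_mul.
Proof.
move=> g; apply: aff_eq.
  by rewrite /aff_trans /aff_lin /= addNr.
exact: (lker0_compVf (aff_linP g)).
Qed.

Lemma aff_Vmul : right_inverse aff_one aff_inv aff_mul.
Proof.
move=> g; apply: aff_eq.
  rewrite {1}/aff_trans /= {2}/aff_trans /= linearN /=.
  by rewrite (lker0_lfunVK (aff_linP g)) subrr.
exact: (lker0_compfV (aff_linP g)).
Qed.

HB.instance Definition _ :=
  isGroup.Build Aff aff_mulA aff_1mul aff_mul1 aff_mulV aff_Vmul.

Lemma aff_act1 x : aff_act 1%g x = x.
Proof. by rewrite /aff_act /aff_trans /aff_lin /= id_lfunE add0r. Qed.

Lemma aff_actM g h x : aff_act (g * h)%g x = aff_act g (aff_act h x).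
Proof.
by rewrite /aff_act /aff_trans /aff_lin /= comp_lfunE linearD /= addrA.
Qed.

End AffineGroup.

Section Coordinates.
Variables (R : realType) (W : vectType R).

Definition vcoord (w : W) : 'rV[R]_(\dim {:W}) := passmx.rVof (vbasis {:W}) w.

(* The unique vector space topology of W, which does not depend on the basis. *)
Definition vect_top : topologicalType := initial_topology vcoord.

End Coordinates.

Section Crystallographic.
Variables (R : realType) (V : vectType R).
Implicit Types (A H : set (Aff V)) (G : groupType).

(* The Lie group topology of Aff V, an open subset of V x End V. *)
HB.instance Definition _ := Topological.copy (Aff V)
  (initial_topology (@aff_val R V : Aff V -> vect_top (V * 'End(V))%type)).

Definition aff_coord (g : Aff V) (i : 'I_(\dim {:(V * 'End(V))%type})) : R :=
  vcoord (aff_val g) ord0 i.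

(* Polynomials in the coordinates of (v, f) suffice: the regular functions of
   Aff V also involve 1 / det f, but denominators can be cleared without
   changing the zero sets in Aff V. *)
Definition zariski_closed A : Prop :=
  exists P : set (mpoly.mpoly (\dim {:(V * 'End(V))%type}) R),
    A = [set g | forall p, P p -> mpoly.meval (aff_coord g) p = 0].

Definition transitive_on_V A : Prop :=
  forall x y : V, exists2 g, A g & aff_act g x = y.

Definition properly_discontinuous H : Prop :=
  forall K : set (vect_top V), compact K ->
    finite_set [set g | H g /\ (aff_act g @` K) `&` K !=set0].

Definition aff_orbit H (x : V) : set V := [set aff_act g x | g in H].

Definition orbit_space H : topologicalType :=
  quotient_topology (fibre_quot (aff_orbit H : vect_top V -> set V)).

Definition affine_crystallographic H : Prop :=
  [/\ is_subgroup H, properly_discontinuous H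
    & compact [set: orbit_space H]].

Definition Homc G A : set {ptws G -> Aff V} :=
  [set rho | [/\ {morph rho : x y / (x * y)%g}, injective rho,
    range rho `<=` A & affine_crystallographic (range rho)]].
Arguments Homc G A : clear implicits.

Definition conj_class G A (rho : G -> Aff V) : set (G -> Aff V) :=
  [set (fun x => a * rho x * a^-1)%g | a in A].

Definition Dc_quot G A :=
  fibre_quot (fun rho : Homc G A => conj_class A (val rho)).

Definition Dc G A : topologicalType := quotient_topology (Dc_quot G A).

Definition Dc_class G A (rho : Homc G A) : Dc G A := \pi_(Dc_quot G A) rho.

Definition Dc_repr G A (d : Dc G A) : Homc G A := repr (d : Dc_quot G A).

Lemma conj_classP G A (rho rho' : G -> Aff V) : is_subgroup A ->
  conj_class A rho = conj_class A rho' <->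
  exists2 a, A a & rho' = (fun x => a * rho x * a^-1)%g.
Proof.
move=> sA; split=> [e|[a Aa ->]].
  have : conj_class A rho' rho'.
    exists 1%g; first exact: is_subgroup1.
    by apply/funext => x; rewrite invg1 mulg1 mul1g.
  by rewrite -e => -[a Aa <-]; exists a.
apply/seteqP; split=> _ [b Ab <-].
  exists (b * a^-1)%g.
    by apply: is_subgroupM => //; apply: is_subgroupV.
  by apply/funext => x; rewrite invgM invgK !mulgA !mulgVK.
exists (b * a)%g; first exact: is_subgroupM.
by apply/funext => x; rewrite invgM !mulgA.
Qed.

Lemma Dc_classP G A (rho rho' : Homc G A) : is_subgroup A ->
  Dc_class rho = Dc_class rho' <->
  exists2 a, A a & (val rho' : G -> Aff V) = (fun x => a * val rho x * a^-1)%g.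
Proof. by move=> sA; rewrite -(conj_classP _ _ sA); exact: pi_fibre. Qed.

Lemma precomp_subproof G A (phi : aut G) (rho : Homc G A) :
  Homc G A (val rho \o (phi^-1)%g).
Proof.
have [rM rI rA rC] : Homc G A (val rho) by exact: set_valP.
have rng : range (val rho \o (phi^-1)%g) = range (val rho).
  apply/seteqP; split=> _ [x _ <-]; first by exists ((phi^-1)%g x).
  by exists (phi x) => //=; congr (val rho _); exact: autK.
split; rewrite ?rng //.
  by move=> x y /=; rewrite autM rM.
by move=> x y /rI; apply: can_inj; exact: (autK (phi^-1)%g).
Qed.

Definition precomp G A (phi : aut G) (rho : Homc G A) : Homc G A :=
  SigSub (mem_set (precomp_subproof phi rho)).

Definition out_act G A (o : Out G) (d : Dc G A) : Dc G A :=
  Dc_class (precomp (repr o) (Dc_repr d)).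

Lemma out_actE G A (phi : aut G) (rho : Homc G A) : is_subgroup A ->
  out_act (out_of phi) (Dc_class rho) = Dc_class (precomp phi rho).
Proof.
move=> sA; set psi := repr (out_of phi); set sigma := Dc_repr (Dc_class rho).
have [a Aa ea] : exists2 a, A a &
    (val rho : G -> Aff V) = (fun x => a * val sigma x * a^-1)%g.
  apply: (conj_classP (val sigma) (val rho) sA).1.
  exact: (repr_fibre (fun rho : Homc G A => conj_class A (val rho))).
have [_ [c _ <-] ec] : [set (phi * y)%g | y in @Inn G] psi.
  have <- : [set (psi * y)%g | y in @Inn G] = [set (phi * y)%g | y in @Inn G].
    exact: (repr_fibre (fun x : aut G => [set (x * y)%g | y in @Inn G])).
  exists 1%g; last by rewrite mulg1.
  by exists 1%g => //; apply: autP => x; rewrite /aut_fun /= invg1 conjg1.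
have [rM _ rA _] : Homc G A (val rho) by exact: set_valP.
apply/(Dc_classP _ _ sA); exists (val rho c * a)%g.
  by apply: is_subgroupM => //; apply: rA; exists c.
apply/funext => x.
have rV y : val rho (y^-1)%g = ((val rho y)^-1)%g.
  have r1 : val rho 1%g = 1%g by apply: (mulgI (val rho 1%g)); rewrite -rM !mulg1.
  by apply: (mulgI (val rho y)); rewrite -rM !mulgV.
have -> : (val (precomp phi rho) x) = val rho ((phi^-1)%g x) by [].
have -> : (val (precomp psi sigma) x) = val sigma ((psi^-1)%g x) by [].
have -> : (psi^-1)%g x = (c^-1 * (phi^-1)%g x * c)%g.
  by rewrite -ec invgM; rewrite -mulgA -conjgE.
have {}ea y : val sigma y = (a^-1 * val rho y * a)%g.
  by rewrite ea /= !mulgA mulVg mul1g mulgVK.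
by rewrite ea !rM rV invgM !mulgA !(mulgK, mulgV, mul1g).
Qed.

(* The fixed points of F = G / H in the space of classes of H. *)
Definition Dc_fixed G (S : pred G) (H : subGroupType S) (nS : normal_in S) A :
    set (Dc H A) :=
  [set d | forall q : cosets [set` S], out_act (beta H nS q) d = d].

End Crystallographic.

Arguments aff_orbit {R V} H x.
Arguments Homc {R V} G A.
Arguments Dc {R V} G A.
Arguments Dc_fixed {R V G S} H nS A.

(* Main.v *)
From HB Require Import structures.
Require Import Defs.
From mathcomp Require Import all_boot all_order all_algebra generic_quotient.
From mathcomp Require Import all_classical all_reals all_analysis.
From mathcomp Require mpoly.

(** Write H for the crystallographic group rho(Gamma) and Z for its centralizer
    in A.  The theorem is the vanishing of the nonabelian cohomology of the
    finite group F = Delta / Gamma with values in Z, in degree 2 for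
    surjectivity and in degree 1 for injectivity.  It vanishes because Z is a
    unipotent group with unique roots, so that averaging over F is possible.

    Z is unipotent.  View V as the affine hyperplane V x 1 of W = V + R, so that
    affine maps become elements of End(W), and let I be the set of
    endomorphisms of W that commute with H and take values in V x 0; it
    contains z - 1 for every z in Z, and it is a ring without unit.  An
    idempotent p of I vanishes ([vertical_projection_eq0]): it splits V into an
    H-invariant affine subspace ker p and an invariant linear complement im p.
    Fix o in ker p and v in im p.  By cocompactness o + t v = g_t k_t with g_t
    in H and k_t in a compact set K.  The ker p components give
    o = g_t (1 - p) k_t, so only finitely many g_t occur, by proper
    discontinuity; then t v, the image under g_t of p k_t, stays bounded for
    all t, whence v = 0.  By Fitting's lemma all elements of I are nilpotent
    ([nil_of_no_projection]), and by Engel's argument I is a nilpotent algebra: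
    it acts strictly triangularly on a canonical flag of W ([flag_full]).  The
    flag gives a filtration of End(W) by depth ([depth_filt]), stable under
    everything that normalizes H.

    Z has roots.  For z in Z the element z - 1 of I is nilpotent, so z has an
    m-th root w in 1 + I ([unipotent_root]).  The coordinates of w^n are
    polynomials in n; the equations of A vanish on them when m divides n, hence
    for all n, and w lies in A ([zariski_closed_root]).

    Averaging.  On the steps of the filtration the group Z is additive, and the
    roots supply the division by the order of F.  A map from Delta to A that
    normalizes H and is multiplicative up to Z can be corrected, one step at a
    time, to a homomorphism ([hom_lifting]); two homomorphisms that agree up to
    Z and on Gamma are conjugate under Z ([hom_conjugacy]).

    A class of representations of Gamma is fixed by F when every conjugation by
    an element of Delta is realized by an element of A; choosing these elements
    gives a map to which [hom_lifting] applies, and the resulting extension of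
    rho is injective because an element of its kernel centralizes Gamma, hence
    lies in Gamma by effectiveness.  Proper discontinuity and cocompactness
    pass between groups of finite index.
*)

Set Implicit Arguments.
Unset Strict Implicit.
Unset Printing Implicit Defensive.

Import Order.TTheory GRing.Theory Num.Theory.
Import numFieldNormedType.Exports.

Local Open Scope classical_set_scope.
Local Open Scope quotient_scope.
Local Open Scope ring_scope.

(** * Averaging in filtered groups *)

(** Modelled on the powers of a two-sided ideal.  By [filt_div] the successive
    quotients are torsion free, so that a mean over a finite set, when it exists,
    is unique modulo the next step. *)
Record ring_filtration (L : pzRingType) (J : nat -> set L) : Prop := {
  filt0 : forall j, J j 0;
  filtB : forall j a b, J j a -> J j b -> J j (a - b);
  filtM : forall i j a b, J i a -> J j b -> J (i + j)%N (a * b);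
  filt_dec : forall j a, J j.+1 a -> J j a;
  filt_div : forall j m a, J j (a *+ m.+1) -> J j a }.

Section Filtration.
Variables (L : pzRingType) (J : nat -> set L) (FJ : ring_filtration J).

Lemma filtN j a : J j a -> J j (- a).
Proof. by move=> Ja; rewrite -sub0r; apply: (filtB FJ) => //; apply: filt0. Qed.

Lemma filtD j a b : J j a -> J j b -> J j (a + b).
Proof. by move=> Ja /filtN Jb; rewrite -[b]opprK; apply: (filtB FJ). Qed.

Lemma filt_le i j a : (i <= j)%N -> J j a -> J i a.
Proof.
move=> /subnK <-; elim: (j - i)%N => [//|k IH] /(filt_dec FJ); exact: IH.
Qed.

Lemma filt_sum (I : Type) (r : seq I) j (F : I -> L) :
  (forall i, J j (F i)) -> J j (\sum_(i <- r) F i).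
Proof. by move=> JF; apply: big_ind => //; [apply: filt0|apply: filtD]. Qed.

Lemma filt_mulrn j m a : J j a -> J j (a *+ m).
Proof.
by move=> Ja; elim: m => [|m IH]; rewrite ?mulrS; [apply: filt0|apply: filtD].
Qed.

(** Every term of the binomial expansion beyond the first order contains v
    twice. *)
Lemma filt_expr_binom i v m : J i.+1 v ->
  J (i + i).+2 ((1 + v) ^+ m - 1 - v *+ m).
Proof.
move=> Jv; elim: m => [|m IH].
  by rewrite expr0 subrr mulr0n subr0; apply: filt0.
set e := (1 + v) ^+ m - 1 - v *+ m in IH.
have -> : (1 + v) ^+ m.+1 - 1 - v *+ m.+1 = e + (e * v + v *+ m * v).
  rewrite {2}/e !mulrBl mul1r subrK exprSr mulrDr mulr1 mulrSr /e.
  by rewrite opprD [RHS]addrACA; congr (_ + _); rewrite addrAC.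
have J2 : J (i + i).+2 (v *+ m * v).
  by rewrite -addSn -addnS; apply: (filtM FJ) => //; exact: filt_mulrn.
apply: filtD => //; apply: filtD => //.
apply: (@filt_le _ ((i + i).+2 + i.+1)); first by rewrite leq_addr.
exact: (filtM FJ).
Qed.

Definition cong k a b := J k (a - b).

Lemma cong_refl k a : cong k a a.
Proof. by rewrite /cong subrr; apply: filt0. Qed.

Lemma cong_sym k a b : cong k a b -> cong k b a.
Proof. by move=> ab; rewrite /cong -opprB; apply: filtN. Qed.

Lemma cong_trans k b a c : cong k a b -> cong k b c -> cong k a c.
Proof. by move=> ab bc; rewrite /cong -(subrK b a) -addrA; apply: filtD. Qed.

Lemma congD k a b c d : cong k a b -> cong k c d -> cong k (a + c) (b + d).
Proof. by move=> ab cd; rewrite /cong opprD addrACA; apply: filtD. Qed.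

Lemma cong_sum (I : Type) (r : seq I) k (F G : I -> L) :
  (forall i, cong k (F i) (G i)) ->
  cong k (\sum_(i <- r) F i) (\sum_(i <- r) G i).
Proof. by move=> FG; rewrite /cong -sumrB; apply: filt_sum. Qed.

End Filtration.

Section FilteredGroup.
Variables (L : pzRingType) (J : nat -> set L) (FJ : ring_filtration J).
Variables (H : groupType) (phi : H -> L).
Hypothesis phi1 : phi 1%g = 1.
Hypothesis phiM : forall x y, phi (x * y)%g = phi x * phi y.
Variable Z : set H.
Hypothesis Zsub : is_subgroup Z.
Hypothesis Z_J : forall z, Z z -> J 1 (phi z - 1).
Hypothesis Z_root : forall z m, Z z -> exists2 w, Z w & (w ^+ m.+1)%g = z.

Definition delta z := phi z - 1.
(** The filtration that J induces on Z.  The shift of the index makes all of Z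
    of level 0, and makes [delta] additive from level j to J (j + 1) / J (j + 2). *)
Definition level j : set H := [set z | Z z /\ J j.+1 (delta z)].

Lemma phiE z : phi z = 1 + delta z. Proof. by rewrite addrC subrK. Qed.

Lemma deltaM z w : delta (z * w)%g = delta z + delta w + delta z * delta w.
Proof.
rewrite {1}/delta phiM !phiE mulrDl mul1r mulrDr mulr1 [1 + _]addrC addrAC addrK.
by rewrite addrA [delta w + _]addrC.
Qed.

Lemma delta1 : delta 1%g = 0. Proof. by rewrite /delta phi1 subrr. Qed.

Lemma level0 z : Z z -> level 0 z.
Proof. by move=> Zz; split => //; exact: Z_J. Qed.

(** The error term delta z * delta w lies twice as deep. *)
Lemma cong_deltaM j z w : level j z -> level j w ->
  cong J j.+2 (delta (z * w)%g) (delta z + delta w).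
Proof.
move=> [_ Jz] [_ Jw]; rewrite /cong deltaM addrAC subrr add0r.
apply: (@filt_le _ _ FJ _ (j.+1 + j.+1)); first by rewrite addSn addnS !ltnS leq_addr.
exact: (filtM FJ).
Qed.

Lemma levelM j z w : level j z -> level j w -> level j (z * w)%g.
Proof.
move=> lz lw; have [[Zz Jz] [Zw Jw]] := (lz, lw); split.
  exact: is_subgroupM.
have := cong_deltaM lz lw => /(filt_dec FJ) c.
by rewrite -(subrK (delta z + delta w) (delta _)); do 2!apply: filtD => //.
Qed.

Lemma phiV z : phi z * phi z^-1%g = 1.
Proof. by rewrite -phiM mulgV phi1. Qed.

Lemma levelV j z : level j z -> level j z^-1%g.
Proof.
move=> [Zz Jz]; split; first exact: is_subgroupV.
have -> : delta z^-1%g = - (delta z + (phi z^-1%g - 1) * delta z).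
  by apply/eqP; rewrite -subr_eq0 opprK addrA -deltaM mulVg delta1.
apply: (filtN FJ); apply: (filtD FJ) => //.
apply: (@filt_le _ _ FJ _ (1 + j.+1)); first by rewrite leq_addl.
by apply: (filtM FJ) => //; apply: Z_J; exact: is_subgroupV.
Qed.

Lemma cong_deltaV j z : level j z -> cong J j.+2 (delta z^-1%g) (- delta z).
Proof.
move=> lz; have := cong_deltaM lz (levelV lz).
rewrite mulgV delta1 /cong sub0r => /(filtN FJ).
by rewrite opprK addrC opprK.
Qed.

Lemma deltaJ g z : delta (g * z * g^-1)%g = phi g * delta z * phi g^-1%g.
Proof. by rewrite /delta !phiM mulrBr mulrBl mulr1 phiV. Qed.

(** Roots do not leave their level: if delta w lies in J (i + 1) with i < j, then
    delta z = m delta w modulo J (2 i + 2), so m delta w and hence delta w lie in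
    J (i + 2). *)
Lemma level_root j m z : level j z ->
  exists2 w, level j w & cong J j.+2 (delta w *+ m.+1) (delta z).
Proof.
move=> [Zz Jz]; have [w Zw wz] := Z_root m Zz.
have phiX k : phi (w ^+ k)%g = (1 + delta w) ^+ k.
  elim: k => [|k IH]; first by rewrite expg0 expr0.
  by rewrite expgS exprS phiM IH [1 + _]addrC /delta subrK.
have dz : delta z = (1 + delta w) ^+ m.+1 - 1 by rewrite -wz /delta phiX.
(* climb the filtration: [dz] gives m delta w one step deeper each time *)
have Jw i : (i <= j)%N -> J i.+1 (delta w).
  elim: i => [_|i IH lt_ij]; first exact: Z_J.
  have Ji := IH (ltnW lt_ij); apply: (filt_div FJ (m := m)).
  rewrite -[_ *+ _](subKr (delta z)); apply: (filtB FJ).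
    by apply: (@filt_le _ _ FJ _ j.+1).
  apply: (@filt_le _ _ FJ _ (i + i).+2); first by rewrite !ltnS leq_addr.
  by rewrite dz; exact: filt_expr_binom.
have lw : level j w by split => //; exact: Jw.
exists w => //; apply: cong_sym => //; rewrite dz.
apply: (@filt_le _ _ FJ _ (j + j).+2); first by rewrite !ltnS leq_addr.
by apply: filt_expr_binom => //; exact: Jw.
Qed.

(** An m-th root of a product of m elements is their mean to first order.  The
    mean is a function of the family F, so families that agree have equal means. *)
Lemma level_mean j m : exists mean : ('I_m.+1 -> H) -> H,
  forall F, (forall i, level j (F i)) -> level j (mean F) /\
    cong J j.+2 (delta (mean F) *+ m.+1) (\sum_i delta (F i)).
Proof.
suff /choice[mean meanP] : forall F : 'I_m.+1 -> H, exists h,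
  (forall i, level j (F i)) -> level j h /\
    cong J j.+2 (delta h *+ m.+1) (\sum_i delta (F i)) by exists mean.
move=> F.
have [lF|] := pselect (forall i, level j (F i)); last by exists 1%g.
have [z lz zF] : exists2 z, level j z & cong J j.+2 (delta z) (\sum_i delta (F i)).
  elim/big_rec: _ => [|i a _ [z lz za]].
    exists 1%g; last by rewrite delta1; apply: cong_refl.
    split; first exact: is_subgroup1.
    by rewrite delta1; apply: filt0.
  exists (F i * z)%g; first exact: levelM.
  apply: (cong_trans FJ (cong_deltaM _ _)) => //.
  by apply: congD => //; apply: cong_refl.
have [w lw wz] := level_root m lz.
by exists w => _; split => //; apply: cong_trans zF.
Qed.

Section Lifting.
Variables (D : groupType) (n : nat) (cls : D -> 'I_n.+1) (r : 'I_n.+1 -> D).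
Hypothesis clsK : cancel r cls.
Hypothesis clsM : forall a x y, (cls (a * x)%g == cls (a * y)%g) = (cls x == cls y).
Hypothesis clsMr : forall a x y, cls x = cls y -> cls (x * a)%g = cls (y * a)%g.
Variable B : set H.
Hypothesis ZB : forall z, Z z -> B z.
Hypothesis BM : forall x y, B x -> B y -> B (x * y)%g.
Hypothesis BZ : forall g z, B g -> Z z -> Z (g * z * g^-1)%g.
Hypothesis BJ : forall g j a, B g -> J j a -> J j (phi g * a * phi g^-1%g).

Lemma level_conj j g z : B g -> level j z -> level j (g * z * g^-1)%g.
Proof. by move=> Bg [Zz Jz]; split; [exact: BZ|rewrite deltaJ; exact: BJ]. Qed.

(** Left translation permutes the classes. *)
Lemma sum_translate (M : nmodType) (f : D -> M) a :
  (forall x y, cls x = cls y -> f x = f y) ->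
  \sum_i f (a * r i)%g = \sum_i f (r i).
Proof.
move=> fP; pose h i := cls (a * r i)%g.
have hI : injective h.
  by move=> i j /eqP; rewrite clsM !clsK => /eqP.
rewrite [RHS](reindex_inj hI) /=; apply: eq_bigr => i _.
by apply: fP; rewrite clsK.
Qed.

(** The nonabelian 2-cocycle of s. *)
Definition defect (s : D -> H) x y := (s x * s y * (s (x * y))^-1)%g.

(** By [ahZ] and [ahcls] both the action of s on Z by conjugation and the cocycle
    [defect] depend on classes only; this makes averages over representatives
    meaningful. *)
Record almost_hom j (s : D -> H) : Prop := {
  ahB : forall x, B (s x);
  ahZ : forall x y z, cls x = cls y -> Z z ->
    (s x * z * (s x)^-1 = s y * z * (s y)^-1)%g;
  ahcls : forall x y a, cls x = cls y ->
    defect s a x = defect s a y /\ defect s x a = defect s y a;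
  ahdef : forall x y, level j (defect s x y) }.

Definition class_function_to (h : D -> H) :=
  (forall x, Z (h x)) /\ forall x y, cls x = cls y -> h x = h y.

(** Modulo the next level the defect c is an additive 2-cocycle, and the sum of
    its cocycle identity c(x,y) + c(xy,f) = x.c(y,f) + c(x,yf) over the classes f
    exhibits c as the coboundary of h x = mean of the c(x,f). *)
Lemma almost_hom_step j s : almost_hom j s ->
  exists2 h, class_function_to h &
    almost_hom j.+1 (fun x => (h x)^-1 * s x)%g.
Proof.
move=> As; have [mean meanP] := level_mean j n.
pose h x := mean (fun i => defect s x (r i)).
have hl x : level j (h x) by have [] := meanP _ (fun i => ahdef As x (r i)).
have hE x : cong J j.+2 (delta (h x) *+ n.+1) (\sum_i delta (defect s x (r i))).
  by have [] := meanP _ (fun i => ahdef As x (r i)).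
have hcls x y : cls x = cls y -> h x = h y.
  move=> xy; congr mean; apply/funext => i.
  by have [_ ->] := ahcls As (r i) xy.
have hZ x : Z (h x) by case: (hl x).
have defE x y : defect (fun x => (h x)^-1 * s x)%g x y =
   ((h x)^-1 * (s x * (h y)^-1 * (s x)^-1) * defect s x y * h (x * y))%g.
  by rewrite /defect invgM invgK !mulgA !mulgVK.
exists h; first by split.
split=> [x|x y z xy Zz|x y a xy|x y].
- by apply: BM; [apply: ZB; exact: is_subgroupV|exact: (ahB As)].
- have aux (a b c : H) : ((a^-1 * b) * c * (a^-1 * b)^-1 = a^-1 * (b * c * b^-1) * a)%g.
    by rewrite invgM invgK !mulgA.
  by rewrite !aux (hcls x y xy) (ahZ As xy Zz).
- have axy : cls (a * x)%g = cls (a * y)%g by apply/eqP; rewrite clsM xy.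
  have xya := clsMr a xy.
  rewrite !defE; have [-> ->] := ahcls As a xy.
  rewrite (hcls _ _ xy) (hcls _ _ axy) (hcls _ _ xya); split=> //.
  by rewrite (ahZ As xy) //; exact: is_subgroupV.
have lc := ahdef As x y.
have lJ : level j (s x * (h y)^-1 * (s x)^-1)%g.
  by apply: level_conj; [exact: (ahB As)|exact: levelV].
have l1 := levelM (levelV (hl x)) lJ; have l2 := levelM l1 lc.
split; first by rewrite defE; case: (levelM l2 (hl (x * y)%g)).
pose X a := phi (s x) * a * phi (s x)^-1%g.
have XD a b : X (a + b) = X a + X b by rewrite /X mulrDr mulrDl.
have XN a : X (- a) = - X a by rewrite /X mulrN mulNr.
have XMn a k : X (a *+ k) = X a *+ k by rewrite /X mulrnAr mulrnAl.
have Xsum (F : 'I_n.+1 -> L) : X (\sum_i F i) = \sum_i X (F i).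
  by rewrite /X mulr_sumr mulr_suml.
have cX k a b : cong J k a b -> cong J k (X a) (X b).
  rewrite /cong => ab; have -> : X a - X b = X (a - b) by rewrite XD XN.
  by apply: BJ => //; exact: (ahB As).
(* the defect of the corrected map, to first order *)
pose u := delta (defect s x y) + delta (h (x * y)%g) -
  (X (delta (h y)) + delta (h x)).
suff Ju : J j.+2 u.
  rewrite defE -(subrK u (delta _)); apply: (filtD FJ) => //.
  rewrite -/(cong J _ _ _); apply: (cong_trans FJ (cong_deltaM l2 (hl _))).
  have -> : u = - delta (h x) - X (delta (h y)) + delta (defect s x y) +
      delta (h (x * y)%g).
    by rewrite /u opprD [- X _ - _]addrC [LHS]addrC addrA.
  apply: (congD FJ) (cong_refl FJ _ _).
  apply: (cong_trans FJ (cong_deltaM l1 lc)).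
  apply: (congD FJ) (cong_refl FJ _ _).
  apply: (cong_trans FJ (cong_deltaM (levelV (hl x)) lJ)).
  apply: (congD FJ); first exact: cong_deltaV.
  by rewrite deltaJ -/(X _) -XN; apply: cX; exact: cong_deltaV.
apply: (filt_div FJ (m := n)).
rewrite mulrnBl [X in X - _]mulrnDl [X in _ - X]mulrnDl -XMn -/(cong J _ _ _).
apply: (cong_trans FJ (congD FJ (cong_refl FJ _ _) (hE _))).
apply: (cong_trans FJ _ (cong_sym FJ (congD FJ (cX _ _ _ (hE y)) (hE x)))).
have <- : \sum_i delta (defect s x (y * r i)%g) = \sum_i delta (defect s x (r i)).
  apply: (sum_translate (f := fun z => delta (defect s x z))) => a b ab.
  by have [-> _] := ahcls As x ab.
rewrite Xsum -big_split /= -[X in _ *+ X]card_ord -sumr_const -big_split /=.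
apply: cong_sum => // i.
(* the cocycle identity, to be summed over the representatives [r i] *)
have e : (defect s x y * defect s (x * y) (r i) =
   (s x * defect s y (r i) * (s x)^-1) * defect s x (y * r i))%g.
  by rewrite /defect !mulgA !mulgVK.
have l3 : level j (s x * defect s y (r i) * (s x)^-1)%g.
  by apply: level_conj; [exact: (ahB As)|exact: (ahdef As)].
apply: (cong_trans FJ (cong_sym FJ (cong_deltaM (ahdef As _ _) (ahdef As _ _)))).
rewrite e /X -deltaJ.
by apply: cong_deltaM => //; exact: (ahdef As).
Qed.

Lemma almost_hom_lift j s : almost_hom 0 s ->
  exists2 h, class_function_to h & almost_hom j (fun x => (h x)^-1 * s x)%g.
Proof.
move=> As; elim: j => [|j [h [hZ hc] /almost_hom_step[k [kZ kc] Ak]]].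
  exists (fun=> 1%g); first by split=> // x; exact: is_subgroup1.
  have -> : (fun x => 1^-1 * s x)%g = s by apply/funext => x; rewrite invg1 mul1g.
  exact: As.
exists (fun x => h x * k x)%g.
  split=> [x|x y xy]; first exact: is_subgroupM.
  by rewrite (hc _ _ xy) (kc _ _ xy).
have -> // : (fun x => (h x * k x)^-1 * s x)%g =
    (fun x => (k x)^-1 * ((h x)^-1 * s x))%g.
by apply/funext => x; rewrite invgM mulgA.
Qed.

(** f g^-1 is a 1-cocycle for the action of g on Z by conjugation. *)
Record near_homs j (f g : D -> H) : Prop := {
  nhM : {morph f : x y / (x * y)%g};
  nhcls : forall x y, cls x = cls y -> (f x * (g x)^-1 = f y * (g y)^-1)%g;
  nhdef : forall x, level j (f x * (g x)^-1)%g }.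

Section Conjugacy.
Variable g : D -> H.
Hypothesis gM : {morph g : x y / (x * y)%g}.
Hypothesis gB : forall x, B (g x).
Hypothesis gZ : forall x y z, cls x = cls y -> Z z ->
    (g x * z * (g x)^-1 = g y * z * (g y)^-1)%g.

(** The averaging of [almost_hom_step] in degree 1: summing the identity
    d(xf) = d(x) + x.d(f) over the classes f shows that d is, modulo the next
    level, the coboundary of the mean of its values. *)
Lemma near_homs_step j f : near_homs j f g ->
  exists2 z, Z z & near_homs j.+1 (fun x => z^-1 * f x * z)%g g.
Proof.
move=> Nf; pose d x := (f x * (g x)^-1)%g.
have [mean meanP] := level_mean j n.
pose z := mean (fun i => d (r i)).
have [lz zE] := meanP _ (fun i => nhdef Nf (r i)); rewrite -/z -/d in lz zE.
have Zz : Z z by case: lz.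
have dE x : (z^-1 * f x * z * (g x)^-1 = z^-1 * d x * (g x * z * (g x)^-1))%g.
  by rewrite /d !mulgA !mulgVK.
exists z => //; split=> [x y|x y xy|x].
- by rewrite (nhM Nf) !mulgA mulgK.
- by rewrite !dE /d (nhcls Nf xy) (gZ xy Zz).
have lJ w : level j w -> level j (g x * w * (g x)^-1)%g by exact: level_conj.
have ld y : level j (d y) := nhdef Nf y.
have l1 := levelM (levelV lz) (ld x).
rewrite dE; split; first by case: (levelM l1 (lJ _ lz)).
pose X a := phi (g x) * a * phi (g x)^-1%g.
have XD a b : X (a + b) = X a + X b by rewrite /X mulrDr mulrDl.
have XN a : X (- a) = - X a by rewrite /X mulrN mulNr.
have XMn a k : X (a *+ k) = X a *+ k by rewrite /X mulrnAr mulrnAl.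
have Xsum (F : 'I_n.+1 -> L) : X (\sum_i F i) = \sum_i X (F i).
  by rewrite /X mulr_sumr mulr_suml.
pose u := delta (d x) + X (delta z) - delta z.
suff Ju : J j.+2 u.
  rewrite -(subrK u (delta _)); apply: (filtD FJ) => //.
  rewrite -/(cong J _ _ _); apply: (cong_trans FJ (cong_deltaM l1 (lJ _ lz))).
  have -> : u = - delta z + delta (d x) + X (delta z).
    by rewrite /u addrC addrA.
  rewrite deltaJ -/(X _); apply: (congD FJ) (cong_refl FJ _ _).
  apply: (cong_trans FJ (cong_deltaM (levelV lz) (ld x))).
  by apply: (congD FJ) (cong_refl FJ _ _); exact: cong_deltaV.
apply: (filt_div FJ (m := n)).
rewrite mulrnBl [X in X - _]mulrnDl -XMn -/(cong J _ _ _).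
apply: (cong_trans FJ _ (cong_sym FJ zE)).
have <- : \sum_i delta (d (x * r i)%g) = \sum_i delta (d (r i)).
  by apply: (sum_translate (f := fun y => delta (d y))) => a b /(nhcls Nf);
    rewrite -/(d a) -/(d b) => ->.
have cX : cong J j.+2 (X (delta z *+ n.+1)) (X (\sum_i delta (d (r i)))).
  rewrite /cong -XN -XD; exact: BJ.
apply: (cong_trans FJ (congD FJ (cong_refl FJ _ _) cX)).
rewrite Xsum -[X in _ *+ X]card_ord -sumr_const -big_split /=.
apply: cong_sum => // i.
have -> : d (x * r i)%g = (d x * (g x * d (r i) * (g x)^-1))%g.
  by rewrite /d (nhM Nf) gM invgM !mulgA !mulgVK.
rewrite /X -deltaJ; apply: (cong_sym FJ); apply: cong_deltaM => //.
exact: lJ.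
Qed.

Lemma near_homs_conj j f : near_homs 0 f g ->
  exists2 z, Z z & near_homs j (fun x => z^-1 * f x * z)%g g.
Proof.
move=> Nf; elim: j => [|j [z Zz /near_homs_step[w Zw Nw]]].
  exists 1%g; first exact: is_subgroup1.
  by rewrite (_ : (fun _ => _) = f) //; apply/funext => x; rewrite invg1 mul1g mulg1.
exists (z * w)%g; first exact: is_subgroupM.
rewrite (_ : (fun _ => _) = fun x => w^-1 * (z^-1 * f x * z) * w)%g //.
by apply/funext => x; rewrite invgM !mulgA.
Qed.

End Conjugacy.

Hypothesis phi_inj : injective phi.
Variable depth : nat.
Hypothesis J_depth : forall a, J depth a -> a = 0.

Lemma level_depth z : level depth z -> z = 1%g.
Proof.
move=> [_ /(filt_dec FJ)/J_depth/eqP]; rewrite subr_eq0 -phi1 => /eqP; exact: phi_inj.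
Qed.

(** The vanishing of the degree 2 obstruction. *)
Theorem hom_lifting s : almost_hom 0 s ->
  exists2 h, class_function_to h &
    {morph (fun x => (h x)^-1 * s x)%g : x y / (x * y)%g}.
Proof.
move=> /(almost_hom_lift depth)[h hP Ah]; exists h => // x y.
have := level_depth (ahdef Ah x y); rewrite /defect => /(canRL (mulgVK _)).
by rewrite mul1g.
Qed.

(** The vanishing of degree 1 cohomology. *)
Theorem hom_conjugacy f g : {morph g : x y / (x * y)%g} ->
  (forall x, B (g x)) ->
  (forall x y z, cls x = cls y -> Z z ->
    (g x * z * (g x)^-1 = g y * z * (g y)^-1)%g) ->
  near_homs 0 f g ->
  exists2 z, Z z & forall x, g x = (z^-1 * f x * z)%g.
Proof.
move=> gM gB gZ /(near_homs_conj gM gB gZ depth)[z Zz Nz]; exists z => // x.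
by have /(canRL (mulgVK _)) := level_depth (nhdef Nz x); rewrite mul1g.
Qed.

End Lifting.
End FilteredGroup.

(** * Nil algebras of endomorphisms of V + R *)

Section EndoRing.
Variables (R : realType) (V : vectType R).

(** V is embedded as the affine hyperplane of the (x, 1); affine maps of V are
    the restrictions of the linear maps that preserve the second coordinate. *)
Definition homog := (V * R^o)%type.
HB.instance Definition _ := Vector.on homog.

(** An alias of 'End(homog) that carries composition as ring product. *)
Definition endo := 'End(homog).
HB.instance Definition _ := Vector.on endo.

Lemma endo1_neq0 : (\1%VF : endo) != 0.
Proof.
apply/eqP => /lfunP/(_ (0, 1)); rewrite id_lfunE lfunE => -[/eqP].
by rewrite oner_eq0.
Qed.

HB.instance Definition _ := GRing.Zmodule_isNzRing.Build endo
  (@comp_lfunA _ _ _ _ _) (@comp_lfun1l _ _ _) (@comp_lfun1r _ _ _)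
  (@comp_lfunDl _ _ _ _) (@comp_lfunDr _ _ _ _) endo1_neq0.
HB.instance Definition _ := GRing.Lmodule_isLalgebra.Build R endo
  (fun k x y => comp_lfunZl k x y).
HB.instance Definition _ := GRing.Lalgebra_isAlgebra.Build R endo
  (fun k x y => comp_lfunZr k x y).

Lemma endoM (u v : endo) w : (u * v) w = u (v w).
Proof. exact: comp_lfunE. Qed.

Lemma endo1 w : (1 : endo) w = w.
Proof. exact: id_lfunE. Qed.

End EndoRing.

Section Subspaces.
Variables (R : realType) (U : vectType R).

Definition linear_set (S : set U) : Prop :=
  S 0 /\ forall (a : R) x y, S x -> S y -> S (a *: x + y).

(** A subspace of maximal dimension among those contained in S exhausts S. *)
Lemma linear_set_vspace (S : set U) : linear_set S ->
  exists X : {vspace U}, forall x, x \in X <-> S x.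
Proof.
move=> [S0 SP].
pose fits n := `[< exists X : {vspace U}, \dim X = n /\ {in X, forall x, S x} >].
have ex : exists n, fits n.
  exists 0%N; apply/asboolP; exists 0%VS; rewrite dimv0; split=> // x.
  by rewrite memv0 => /eqP ->.
have ub n : fits n -> (n <= \dim {:U})%N.
  by move=> /asboolP[X [<- _]]; exact: dimvS (subvf X).
case: (ex_maxnP ex ub) => _ /asboolP[X [<- XS]] maxX.
exists X => x; split=> [|Sx]; first exact: XS.
have : fits (\dim (X + <[x]>)%VS).
  apply/asboolP; exists (X + <[x]>)%VS; split=> // y.
  move=> /memv_addP[y1 y1X [y2 /vlineP[k ->] ->]].
  by rewrite addrC; apply: SP => //; exact: XS.
move=> /maxX dX; have /eqP -> : (X == X + <[x]>)%VS by rewrite eqEdim addvSl.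
by apply: subvP (addvSr X _) _ _; exact: memv_line.
Qed.

End Subspaces.

Section Nilpotent.
Variables (R : realType) (V : vectType R).
Local Notation W := (homog V).
Local Notation E := (endo V).

Record nonunital_subalgebra (I : set E) : Prop := {
  nsaL : linear_set I;
  nsaM : forall u v, I u -> I v -> I (u * v) }.

Section Engel.
Variable I : set E.
Hypothesis Ialg : nonunital_subalgebra I.
Hypothesis Inil : forall u, I u -> exists k, u ^+ k = 0.

(** Choose v outside U with I v + U of minimal dimension.  If a v were outside U
    for some a in I, minimality would give I (a v) + U = I v + U, hence
    a v = b (a v) modulo U with b in I nilpotent, so a v would lie in U. *)
Lemma engel (U : {vspace W}) : (forall u w, I u -> w \in U -> u w \in U) ->
  U != fullv -> exists2 v, v \notin U & forall u, I u -> u v \in U.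
Proof.
move=> IU Uf; have [I0 IL] := nsaL Ialg.
have XP v : exists X : {vspace W}, forall w, w \in X <-> exists2 u, I u & w - u v \in U.
  apply: linear_set_vspace; split.
    by exists 0 => //; rewrite lfunE /= subr0 mem0v.
  move=> a x y [u Iu xu] [u' Iu' yu'].
  exists (a *: u + u'); first exact: IL.
  rewrite !lfunE /= lfunE /= opprD addrACA -scalerBr.
  by rewrite memvD // memvZ.
pose fits n := `[< exists v (X : {vspace W}), [/\ v \notin U, \dim X = n &
  forall w, w \in X <-> exists2 u, I u & w - u v \in U] >].
have ex : exists n, fits n.
  have [v vU] : exists v, v \notin U.
    apply: contrapT => /forallNP h; case/negP: Uf; rewrite eqEsubv subvf /=.
    by apply/subvP => v _; apply: contrapT => /negP; exact: h.
  by have [X hX] := XP v; exists (\dim X); apply/asboolP; exists v, X.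
case: (ex_minnP ex) => _ /asboolP[v [X [vU <- hX]]] minX.
exists v => // a Ia; apply: contrapT => /negP avU.
have [X' hX'] := XP (a v).
have /eqP XX' : X' == X.
  rewrite eqEdim; apply/andP; split.
    apply/subvP => w /hX'[u Iu wu]; apply/hX; exists (u * a).
      exact: (nsaM Ialg).
    by rewrite endoM.
  by apply: minX; apply/asboolP; exists (a v), X'.
have : a v \in X by apply/hX; exists a => //; rewrite subrr mem0v.
rewrite -XX' => /hX'[b Ib avb]; have [k bk] := Inil Ib.
case/negP: avU; rewrite -[a v]subr0.
have -> : (0 : W) = (b ^+ k) (a v) by rewrite bk lfunE.
elim: k {bk} => [|k IH]; first by rewrite expr0 endo1 subrr mem0v.
rewrite exprS endoM -(subrK (b (a v)) (a v)) -addrA memvD // subrK -linearB /=.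
exact: IU.
Qed.

(** The vectors killed by all products of i elements of I.  It is defined from I
    alone, so that whatever normalizes I preserves it. *)
Fixpoint flag i : set W :=
  if i is i'.+1 then [set w | forall u, I u -> flag i' (u w)] else [set 0].

Definition depth_filt j : set E :=
  [set u | forall i w, flag (i + j) w -> flag i (u w)].

Lemma flag_linear i : linear_set (flag i).
Proof.
elim: i => [|i [K0 KL]]; split=> //=.
- by move=> a x y -> ->; rewrite scaler0 addr0.
- by move=> u Iu; rewrite linear0.
- by move=> a x y Kx Ky u Iu; rewrite linearP; apply: KL; [exact: Kx|exact: Ky].
Qed.

Lemma flagZ i a w : flag i w -> flag i (a *: w).
Proof.
move=> Kw; have [K0 KL] := flag_linear i.
by rewrite -[_ *: _]addr0; exact: KL.
Qed.

Lemma flagB i w w' : flag i w -> flag i w' -> flag i (w - w').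
Proof.
move=> Kw Kw'; have [K0 KL] := flag_linear i.
by rewrite addrC -scaleN1r; exact: KL.
Qed.

Lemma flagS i w : flag i w -> flag i.+1 w.
Proof.
elim: i w => [|i IH] w /=; first by move=> -> u _; rewrite linear0.
by move=> Kw u Iu; apply: IH; exact: Kw.
Qed.

(** By [engel] the flag of I grows strictly until it reaches the whole space. *)
Lemma flag_full : exists d, forall w, flag d w.
Proof.
have step n : (n <= \dim {:W})%N -> exists U : {vspace W},
    [/\ (n <= \dim U)%N, (forall u w, I u -> w \in U -> u w \in U) &
     exists d, forall w, w \in U -> flag d w].
  elim: n => [_|n IH lt_n].
    exists 0%VS; split=> // [u w _|].
      by rewrite memv0 => /eqP ->; rewrite linear0 mem0v.
    by exists 0%N => w; rewrite memv0 => /eqP.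
  have [U [nU IU [d Ud]]] := IH (ltnW lt_n).
  have [Uf|Unf] := eqVneq U fullv; first by exists U; split=> //; [rewrite Uf|exists d].
  have [v vU Iv] := engel IU Unf.
  have IUv u w : I u -> w \in (U + <[v]>)%VS -> u w \in U.
    move=> Iu /memv_addP[x xU [y /vlineP[k ->] ->]].
    by rewrite linearD linearZ; apply: memvD; [exact: IU|apply: memvZ; exact: Iv].
  exists (U + <[v]>)%VS; split.
  - rewrite (leq_ltn_trans nU) // ltnNge; apply/negP => le.
    have /eqP e : (U == U + <[v]>)%VS by rewrite eqEdim addvSl.
    by case/negP: vU; rewrite e; apply: subvP (addvSr _ _) _ _; exact: memv_line.
  - by move=> u w Iu wU; apply: subvP (addvSl _ _) _ _; exact: IUv wU.
  - by exists d.+1 => w wU u Iu; apply: Ud; exact: IUv wU.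
have [U [dU _ [d Ud]]] := step _ (leqnn _).
exists d => w; apply: Ud; have /eqP -> : (U == fullv)%VS by rewrite eqEdim subvf.
exact: memvf.
Qed.

Lemma depth_filtP : ring_filtration depth_filt.
Proof.
split.
- by move=> j i w _; rewrite lfunE /=; case: (flag_linear i).
- move=> j a b Ja Jb i w Kw; rewrite !lfunE /= lfunE /=.
  by apply: flagB; [exact: Ja|exact: Jb].
- by move=> i j a b Ja Jb k w Kw; rewrite endoM; apply/Ja/Jb; rewrite -addnA.
- by move=> j a Ja i w Kw; apply: Ja; rewrite addnS; exact: flagS.
- move=> j m a Ja i w /Ja.
  have -> : (a *+ m.+1) w = m.+1%:R *: a w.
    by rewrite -scaler_nat lfunE.
  by move=> /(flagZ m.+1%:R^-1); rewrite scalerA mulVf ?pnatr_eq0 // scale1r.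
Qed.

Lemma depth_filt1 u : I u -> depth_filt 1 u.
Proof. by move=> Iu i w; rewrite addn1; exact. Qed.

Lemma depth_filt_sep : exists d, forall u, depth_filt d u -> u = 0.
Proof.
have [d Kd] := flag_full; exists d => u Ju; apply/lfunP => w.
by rewrite lfunE /=; exact: (Ju 0 w (Kd w)).
Qed.

Lemma depth_filt_conj g g' : g * g' = 1 -> g' * g = 1 ->
  (forall u, I u -> I (g * u * g')) -> (forall u, I u -> I (g' * u * g)) ->
  forall j u, depth_filt j u -> depth_filt j (g * u * g').
Proof.
have flagJ h h' : h * h' = 1 -> (forall u, I u -> I (h' * u * h)) ->
    forall i w, flag i w -> flag i (h w).
  move=> hh' hI; elim=> [|i IH] w /=; first by move=> ->; rewrite linear0.
  move=> Kw u Iu; have -> : u (h w) = h ((h' * u * h) w).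
    by rewrite -[RHS]endoM !mulrA hh' mul1r endoM.
  by apply: IH; apply: Kw; exact: hI.
move=> gg' g'g Ig Ig' j u Ju i w Kw; rewrite !endoM.
apply: (flagJ g g') => //; apply: Ju; exact: (flagJ g' g).
Qed.

(** Successive approximation: if (1 + v)^m = 1 + u - w with w at depth N, then
    (1 + v) (1 + w / m) is a root of 1 + u up to depth N + 1. *)
Lemma unipotent_root u m : I u ->
  exists2 v, I v & (1 + v) ^+ m.+1 = 1 + u.
Proof.
move=> Iu; have [I0 IL] := nsaL Ialg; have IM := nsaM Ialg.
have IZ a x : I x -> I (a *: x) by move=> Ix; rewrite -[_ *: _]addr0; exact: IL.
have ID x y : I x -> I y -> I (x + y) by move=> Ix; rewrite -[x]scale1r; exact: IL.
have FJ := depth_filtP.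
have IX v k : I v -> I ((1 + v) ^+ k - 1).
  move=> Iv; elim: k => [|k IH]; first by rewrite expr0 subrr.
  rewrite exprS mulrDl mul1r addrAC; apply: (ID) => //.
  rewrite -[_ ^+ k](subrK 1) mulrDr mulr1; apply: (ID) => //; exact: IM.
(* the approximations v are kept in the commutant of u, so that the first-order
   correction of 1 + v is an honest binomial expansion *)
suff approx N : exists v, [/\ I v, GRing.comm v u &
    depth_filt N.+1 (1 + u - (1 + v) ^+ m.+1)].
  have [d Jd] := depth_filt_sep; have [v [Iv _ /(filt_dec FJ)/Jd/eqP]] := approx d.
  by rewrite subr_eq0 => /eqP e; exists v.
elim: N => [|N [v [Iv vu Jw]]].
  exists 0; split; [exact: I0|by rewrite /GRing.comm mul0r mulr0|].
  by rewrite addr0 expr1n addrC addKr; exact: depth_filt1.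
set w := 1 + u - _ in Jw; set q := 1 + v in w Jw.
have Iw : I w.
  have -> : w = u + (-1) *: (q ^+ m.+1 - 1).
    by rewrite scaleN1r opprB /w addrAC addrC addrA.
  by apply: ID => //; apply: IZ; exact: IX.
pose y := m.+1%:R^-1 *: w.
have yM : y *+ m.+1 = w.
  by rewrite -scaler_nat scalerA mulfV ?pnatr_eq0 // scale1r.
have qu : GRing.comm q u.
  by apply: commr_sym; apply: commrD; [exact: commr1|exact: commr_sym].
have wq x : GRing.comm x u -> GRing.comm x q -> GRing.comm x w.
  move=> xu xq; apply: commrB; first by apply: commrD => //; exact: commr1.
  exact: commrX.
have yc x : GRing.comm x u -> GRing.comm x q -> GRing.comm x y.
  by move=> xu xq; rewrite /GRing.comm /y -scalerAl -scalerAr wq.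
have Jy : depth_filt N.+1 y by apply: (filt_div FJ (m := m)); rewrite yM.
exists (v + q * y); split.
- have Iy : I y by exact: IZ.
  have -> : q * y = y + v * y by rewrite [LHS]mulrDl mul1r.
  by apply: (ID) => //; apply: (ID) => //; exact: IM.
- apply: commr_sym; apply: commrD; first exact: commr_sym.
  apply: commrM; first exact: commr_sym.
  by apply: yc => //; exact: commr_sym.
have -> : 1 + (v + q * y) = q * (1 + y) by rewrite mulrDr mulr1 addrA.
rewrite exprMn_comm; last by apply: commrD; [exact: commr1|apply: yc].
have Je := filt_expr_binom FJ m.+1 Jy; rewrite yM in Je.
set e := _ - w in Je.
have -> : (1 + y) ^+ m.+1 = 1 + w + e.
  by rewrite /e -addrA [w + _]addrC subrK addrC subrK.
set p := q ^+ m.+1.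
have Jp : depth_filt 1 (p - 1) by apply/depth_filt1/IX.
have -> : 1 + u - p * (1 + w + e) = - ((p - 1) * w + (e + (p - 1) * e)).
  have -> : e + (p - 1) * e = p * e by rewrite mulrBl mul1r addrC subrK.
  rewrite mulrBl mul1r [p * w - w + _]addrAC opprB.
  by rewrite !mulrDr mulr1 -[p + _ + _]addrA opprD addrA.
apply: (filtN FJ); apply: (filtD FJ).
  by rewrite -add1n; exact: (filtM FJ).
have Je' : depth_filt N.+2 e.
  by apply: (filt_le FJ) Je; rewrite !ltnS leq_addr.
apply: (filtD FJ) => //; apply: (filt_dec FJ).
by rewrite -[N.+3]add1n; exact: (filtM FJ).
Qed.

End Engel.

Section Commutant.
Variable G : set E.

(** The differences between two affine maps that commute with G. *)
Definition vertical_commutant : set E :=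
  [set u : E | (forall w, (u w).2 = 0) /\ forall g, G g -> u * g = g * u].

Lemma vertical_commutantP : nonunital_subalgebra vertical_commutant.
Proof.
split.
  split; first by split=> [w|g _]; [rewrite lfunE|rewrite mul0r mulr0].
  move=> a x y [x2 xG] [y2 yG]; split=> [w|g Gg].
    by rewrite !lfunE /= lfunE /= x2 y2 scaler0 addr0.
  by rewrite mulrDl mulrDr -scalerAl -scalerAr xG // yG.
move=> u v [u2 uG] [v2 vG]; split=> [w|g Gg]; first by rewrite endoM.
by rewrite -mulrA vG // mulrA uG // mulrA.
Qed.

(** Fitting's lemma: the projection onto the stable image of the powers of u,
    along their kernel, commutes with all that commutes with u, hence vanishes. *)
Lemma nil_of_no_projection :
  (forall p, vertical_commutant p -> p * p = p -> p = 0) ->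
  forall u, vertical_commutant u -> exists k, u ^+ k = 0.
Proof.
move=> noproj u Iu; set I := vertical_commutant in Iu noproj.
have Ik k : I (u ^+ k.+1).
  elim: k => [//|k IH]; rewrite exprS.
  exact: (nsaM vertical_commutantP).
(* an exponent at which the image of the powers of u is stable *)
pose fits n := `[< exists k, \dim (limg (u ^+ k.+1)) = n >].
have ex : exists n, fits n by exists (\dim (limg (u ^+ 1))); apply/asboolP; exists 0%N.
case: (ex_minnP ex) => _ /asboolP[k <-] mink; exists k.+1.
set f := u ^+ k.+1 in mink *.
have If : I f := Ik k.
have ff : (f @: limg f = limg f)%VS.
  apply/eqP; rewrite eqEdim limgS ?subvf //=.
  rewrite -limg_comp; apply: mink; apply/asboolP.
  by exists (k + k.+1)%N; rewrite -addSn exprD.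
have dis : (limg f :&: lker f = 0)%VS.
  apply/eqP; rewrite -dimv_eq0; have := limg_ker_dim f (limg f).
  by rewrite ff => /eqP; rewrite -[X in _ == X]add0n eqn_add2r.
have tot : (limg f + lker f = fullv)%VS.
  apply/eqP; rewrite eqEdim subvf /= dimv_disjoint_sum // addnC.
  by have := limg_ker_dim f fullv; rewrite capfv => ->.
pose p : E := daddv_pi (limg f) (lker f).
have pim w : p w \in limg f by exact: memv_pi.
have pid w : w \in limg f -> p w = w by exact: daddv_pi_id.
have pker w : w \in lker f -> p w = 0.
  move=> wk; have wt : w \in (limg f + lker f)%VS by rewrite tot memvf.
  have := daddv_pi_add dis wt; rewrite [X in _ + X]daddv_pi_id 1?capvC //.
  by move/(canRL (addrK _)); rewrite subrr.
have pI : I p.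
  split=> [w|g Gg]; first by have /memv_imgP[x _ ->] := pim w; case: If.
  have fg : f * g = g * f by case: If => _; exact.
  apply/lfunP => w; rewrite -[LHS]/((p * g) w) -[RHS]/((g * p) w) !endoM.
  have : w \in (limg f + lker f)%VS by rewrite tot memvf.
  move=> /memv_addP[_ /memv_imgP[x _ ->] [b bk ->]].
  rewrite !linearD /= (pid (f x)) ?memv_img ?memvf // (pker b) // linear0 addr0.
  rewrite pid ?pker ?addr0 //.
    rewrite memv_ker -endoM fg endoM.
    by move: bk; rewrite memv_ker => /eqP ->; rewrite linear0.
  by rewrite -endoM -fg endoM memv_img ?memvf.
have p0 : p = 0.
  by apply: noproj => //; apply/lfunP => w; rewrite -[LHS]/((p * p) w) endoM pid.
apply/lfunP => w; rewrite -(pid (f w)) ?memv_img ?memvf // p0 !lfunE //.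
Qed.

End Commutant.
End Nilpotent.

(** * Cocompact groups of affine maps *)

Section VectTop.
Variable R : realType.

Lemma mulmxr_continuous m n (A : 'M[R]_(m, n)) :
  continuous (fun v : 'rV[R]_m => v *m A).
Proof.
rewrite (_ : (fun v => v *m A) = (fun v => \sum_i v 0 i *: row i A)); last first.
  by apply/funext => w; exact: mulmx_sum_row.
apply: continuous_big => [|i _]; first exact: add_continuous.
move=> v; apply: cvgZr_tmp; first exact: (nbhs_filter v).
exact: (@coord_continuous R 1 m 0 i v).
Qed.

Variable V : vectType R.
Local Notation T := (vect_top V).

Lemma vcoord_linear : linear (@vcoord R V).
Proof. exact: passmx.rVof_linear. Qed.

HB.instance Definition _ := GRing.isLinear.Build R V 'rV[R]_(\dim {:V}) _
  (@vcoord R V) vcoord_linear.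

Definition vcoord_inv : 'rV[R]_(\dim {:V}) -> V := passmx.vecof (vbasis {:V}).

Lemma vcoordK : cancel (@vcoord R V) vcoord_inv.
Proof. exact: passmx.rVofK (vbasisP _). Qed.

Lemma vcoord_invK : cancel vcoord_inv (@vcoord R V).
Proof. exact: passmx.vecofK (vbasisP _). Qed.

Lemma vcoord_continuous : continuous (@vcoord R V : T -> _).
Proof. exact: initial_continuous. Qed.

Lemma vcoord_inv_continuous : continuous (vcoord_inv : _ -> T).
Proof.
apply: continuous_comp_initial => x.
by rewrite (_ : _ \o _ = id) //; apply/funext => y /=; exact: vcoord_invK.
Qed.

Lemma affine_continuous (t : V) (f : 'End(V)) :
  continuous ((fun x => t + f x) : T -> T).
Proof.
pose A := passmx.mxof (vbasis {:V}) (vbasis {:V}) f.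
apply: continuous_comp_initial.
rewrite (_ : _ \o _ = (fun v => vcoord t + v *m A) \o (@vcoord R V)); last first.
  apply/funext => y /=; rewrite linearD; congr (_ + _).
  exact: (passmx.rVof_app (vbasis _) (vbasisP _)).
move=> x.
apply: (@continuous_comp T _ _ (@vcoord R V) (fun v => vcoord t + v *m A)).
  exact: vcoord_continuous.
apply: (@cvgD R _ _ (nbhs (vcoord x)) _ (fun=> vcoord t) (fun v => v *m A)).
  exact: cvg_cst.
exact: mulmxr_continuous.
Qed.

Lemma vect_top_compact_bounded (K : set T) : compact K ->
  exists M : R, forall x, K x -> `|vcoord x| <= M.
Proof.
move=> cK.
have /compact_bounded[M [_ hM]] : compact ((@vcoord R V : T -> _) @` K).
  by apply: continuous_compact => //; apply/continuous_subspaceT/vcoord_continuous.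
exists (M + 1) => x Kx; apply: (hM (M + 1)); first by rewrite ltrDl.
by exists x.
Qed.

Lemma ball_compact (M : R) : compact [set x : T | `|vcoord x| <= M].
Proof.
rewrite (_ : [set x | _] = vcoord_inv @` [set v | `|v| <= M]); last first.
  apply/seteqP; split=> [x /= xM|_ [v /= vM <-]]; last by rewrite /= vcoord_invK.
  by exists (vcoord x) => //; exact: vcoordK.
apply: continuous_compact; first exact/continuous_subspaceT/vcoord_inv_continuous.
apply: bounded_closed_compact.
  by exists M; split=> [|N MN v /= vM]; [exact: num_real|exact: le_trans vM (ltW MN)].
have := @closed_comp _ _ (fun v : 'rV[R]_(\dim {:V}) => `|v|) [set x | x <= M].
apply; last exact: closed_le.
by move=> v _; exact: norm_continuous.
Qed.

Lemma ball_open (M : R) : open [set x : T | `|vcoord x| < M].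
Proof.
apply: (@open_comp _ _ (fun x : T => `|vcoord x|) [set y | y < M]).
  move=> x _; apply: (@continuous_comp _ _ _ (@vcoord R V : T -> _) Num.norm).
    exact: vcoord_continuous.
  exact: norm_continuous.
exact: open_lt.
Qed.

Lemma finite_bigcup_compact (I : choiceType) (X : topologicalType) (D : set I)
    (F : I -> set X) :
  finite_set D -> (forall i, compact (F i)) -> compact (\bigcup_(i in D) F i).
Proof.
move=> fD cF; rewrite -bigsetU_fset_set //; exact: bigsetU_compact.
Qed.

End VectTop.

Section Cocompact.
Variables (R : realType) (V : vectType R).
Implicit Types (H : set (Aff V)) (g : Aff V).
Local Notation T := (vect_top V).

Lemma aff_act_continuous g : continuous (aff_act g : T -> T).
Proof. exact: affine_continuous. Qed.

Lemma compact_aff_image g (K : set T) : compact K -> compact (aff_act g @` K : set T).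
Proof.
move=> cK; apply: continuous_compact => //.
by apply/continuous_subspaceT/aff_act_continuous.
Qed.

Lemma aff_actK g : cancel (aff_act g) (aff_act g^-1%g).
Proof. by move=> x; rewrite -aff_actM mulVg aff_act1. Qed.

Definition cocompact H : Prop := exists2 K : set T, compact K &
  forall x : V, exists2 g, H g & exists2 k, K k & x = aff_act g k.

Lemma pi_orbitP H x y : is_subgroup H ->
  \pi_(fibre_quot (aff_orbit H : T -> set V)) x =
  \pi_(fibre_quot (aff_orbit H : T -> set V)) y <->
  exists2 g, H g & y = aff_act g x.
Proof.
move=> sH; split=> [/pi_fibre e|[g Hg ->]].
  have : aff_orbit H y y by exists 1%g; [exact: is_subgroup1|exact: aff_act1].
  by rewrite -e => -[g Hg <-]; exists g.
apply/pi_fibre/seteqP; split=> _ [h Hh <-].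
  exists (h * g^-1)%g; first by apply: is_subgroupM => //; exact: is_subgroupV.
  by rewrite aff_actM aff_actK.
by exists (h * g)%g; [exact: is_subgroupM|rewrite aff_actM].
Qed.

(** The orbit map is open and V is exhausted by open balls of compact closure;
    finitely many, hence one, of their images cover a compact quotient. *)
Lemma cocompactP H : is_subgroup H ->
  compact [set: orbit_space H] <-> cocompact H.
Proof.
move=> sH; pose Q := fibre_quot (aff_orbit H : T -> set V).
have piS (q : orbit_space H) : exists x : T, \pi_Q x = q :> Q.
  by exists (repr (q : Q)); rewrite reprK.
split=> [|[K cK HK]]; last first.
  rewrite (_ : setT = (\pi_Q : T -> orbit_space H) @` K); last first.
    apply/seteqP; split=> // q _; have [x <-] := piS q.
    have [g Hg [k Kk ->]] := HK x; exists k => //.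
    by apply/(pi_orbitP _ _ sH); exists g.
  apply: continuous_compact => //; apply: continuous_subspaceT.
  exact: pi_continuous.
pose B (n : nat) := [set x : T | `|vcoord x| < n%:R].
pose P n q := exists2 x, B n x & \pi_Q x = q :> Q.
move=> /compact_near_coveringP/(_ nat \oo P).
case=> [|N _ cov].
  move=> q _; have [x <-] := piS q; pose n := (Num.truncn `|vcoord x|).+1.
  exists ((\pi_Q : T -> orbit_space H) @` B n, [set m | (n <= m)%N]) => /=.
    split; last by exists n.
    apply: (@open_nbhs_nbhs (orbit_space H)); split; last first.
      by exists x => //; exact: truncnS_gt.
    rewrite /open /= /quotient_topology.quotient_open.
    rewrite (_ : _ @^-1` _ = \bigcup_(g in H) (aff_act g @^-1` B n)).
      apply: bigcup_open => g _; apply: (@open_comp T T).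
        by move=> y _; exact: aff_act_continuous.
      exact: (@ball_open R V n%:R).
    apply/seteqP; split=> [y [z Bz /esym/(pi_orbitP _ _ sH)[g Hg zE]]|y [g Hg Bgy]].
      by exists g => //=; rewrite -zE.
    by exists (aff_act g y) => //; apply/esym/(pi_orbitP _ _ sH); exists g.
  move=> [_ m] /= [[y By <-] nm]; exists y => //.
  by apply: lt_le_trans By _; rewrite ler_nat.
exists [set x : T | `|vcoord x| <= N%:R]; first exact: ball_compact.
move=> x; have [y By /(pi_orbitP _ _ sH)[g Hg xE]] := cov N (leqnn N) (\pi_Q x) I.
by exists g => //; exists y => //=; exact: ltW.
Qed.

Lemma crystallographic_finite_ext H1 H2 (I : finType) (r : I -> Aff V) :
  is_subgroup H1 -> is_subgroup H2 -> H1 `<=` H2 -> (forall i, H2 (r i)) ->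
  (forall g, H2 g -> exists i, exists2 h, H1 h & g = (r i * h)%g) ->
  affine_crystallographic H1 <-> affine_crystallographic H2.
Proof.
move=> s1 s2 s12 Hr rP; split=> -[_ pd /cocompactP cc].
  have [K cK HK] := cc s1.
  split=> //; last first.
    apply/(cocompactP s2); exists K => // x.
    by have [g /s12 Hg Kx] := HK x; exists g.
  move=> C cC.
  (* translates of C that meet C under H2 come from translates of C' under H1 *)
  pose C' : set T := C `|` \bigcup_(i in [set: I]) (aff_act (r i)^-1%g @` C).
  have cC' : compact C'.
    apply: compactU => //; apply: finite_bigcup_compact; first exact: finite_finset.
    by move=> i; exact: compact_aff_image.
  have fin := pd C' cC'.
  apply: sub_finite_set (finite_image2 (fun i h => (r i * h)%g)
    (finite_finset : finite_set [set: I]) fin).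
  move=> g [Hg [_ [[x Cx <-] Cgx]]]; have [i [h Hh gE]] := rP g Hg.
  exists i => //; exists h => //; split=> //.
  exists (aff_act h x); split; first by exists x => //; left.
  right; exists i => //; exists (aff_act g x) => //.
  by rewrite gE aff_actM aff_actK.
have [K cK HK] := cc s2.
split=> //.
  by move=> C cC; apply: sub_finite_set (pd C cC) => g [Hg]; split=> //; exact: s12.
apply/(cocompactP s1); exists (\bigcup_(i in [set: I]) (aff_act (r i)^-1%g @` K)).
  apply: finite_bigcup_compact; first exact: finite_finset.
  by move=> i; exact: compact_aff_image.
move=> x; have [g Hg [k Kk xE]] := HK x.
have [i [h Hh gE]] := rP _ (is_subgroupV s2 Hg).
exists h^-1%g; first exact: is_subgroupV.
exists (aff_act (r i)^-1%g k); first by exists i => //; exists k.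
by rewrite -aff_actM -invgM -gE invgK.
Qed.

End Cocompact.

(** * Affine maps as linear maps, Zariski-closed groups *)

Section Linearization.
Variables (R : realType) (V : vectType R).
Local Notation E := (endo V).
Implicit Types (g h : Aff V) (u : E).

Definition affine_map (p : V * 'End(V)) (w : homog V) : homog V :=
  (p.2 w.1 + w.2 *: p.1, w.2).

Lemma affine_map_linear p : linear (affine_map p).
Proof.
move=> a x y; congr (_, _) => /=.
by rewrite linearP scalerDr scalerDl scalerA addrACA.
Qed.

HB.instance Definition _ p :=
  GRing.isLinear.Build R (homog V) (homog V) _ (affine_map p) (affine_map_linear p).

Definition affine_endo (p : V * 'End(V)) : E := linfun (affine_map p).

Lemma affine_endoE p w : affine_endo p w = (p.2 w.1 + w.2 *: p.1, w.2).
Proof. exact: lfunE. Qed.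

Definition horizontal_part (u : E) (v : V) : V := (u (v, 0)).1.

Lemma horizontal_part_linear u : linear (horizontal_part u).
Proof.
move=> a x y; rewrite /horizontal_part.
have -> : (a *: x + y, 0) = a *: (x, 0) + (y, 0) :> homog V.
  by congr (_, _); rewrite /= scaler0 addr0.
by rewrite linearP.
Qed.

HB.instance Definition _ u := GRing.isLinear.Build R V V _
  (horizontal_part u) (horizontal_part_linear u).

Definition affine_part (u : E) : V * 'End(V) :=
  ((u (0, 1)).1, linfun (horizontal_part u)).

Lemma affine_part2E u v : (affine_part u).2 v = (u (v, 0)).1.
Proof. exact: lfunE. Qed.

Lemma affine_part_linear : linear affine_part.
Proof.
move=> a u v; congr (_, _); first by rewrite /= lfunE /= lfunE.
apply/lfunP => x; rewrite (affine_part2E (a *: u + v)) lfunE /= lfunE /=.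
by rewrite lfunE /= lfunE /= !affine_part2E.
Qed.

HB.instance Definition _ := GRing.isLinear.Build R E (V * 'End(V))%type _
  affine_part affine_part_linear.

Lemma homog_split (w : homog V) : w = (w.1, 0) + w.2 *: (0, 1).
Proof.
by case: w => x s; congr (_, _) => /=; rewrite ?scaler0 ?addr0 // add0r [RHS]mulr1.
Qed.

Lemma affine_partK u : (forall w, (u w).2 = w.2) -> affine_endo (affine_part u) = u.
Proof.
move=> u2; apply/lfunP => w; rewrite affine_endoE affine_part2E /=.
rewrite [in RHS](surjective_pairing (u w)) u2; congr (_, _).
by rewrite [in RHS](homog_split w) linearD linearZ.
Qed.

Lemma affine_endoK p : affine_part (affine_endo p) = p.
Proof.
case: p => t f; congr (_, _) => /=.
  by rewrite affine_endoE /= linear0 add0r scale1r.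
apply/lfunP => x; rewrite (affine_part2E (affine_endo (t, f))) affine_endoE /=.
by rewrite scale0r addr0.
Qed.

Definition linearize g : E := affine_endo (aff_val g).

Lemma linearizeE g w : linearize g w = (aff_lin g w.1 + w.2 *: aff_trans g, w.2).
Proof. exact: affine_endoE. Qed.

Lemma linearize_act g x : linearize g (x, 1) = (aff_act g x, 1).
Proof. by rewrite linearizeE /= scale1r addrC. Qed.

Lemma linearize_inj : injective linearize.
Proof. by move=> g h /(congr1 affine_part); rewrite !affine_endoK => /val_inj. Qed.

Lemma linearizeM g h : linearize (g * h)%g = linearize g * linearize h.
Proof.
apply/lfunP => w; rewrite endoM !linearizeE /=; congr (_, _).
have -> : aff_lin (g * h)%g = (aff_lin g \o aff_lin h)%VF by [].
have -> : aff_trans (g * h)%g = aff_trans g + aff_lin g (aff_trans h) by [].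
by rewrite comp_lfunE scalerDr [aff_lin g (_ + _)]linearD linearZ addrA addrAC.
Qed.

Lemma linearize1 : linearize 1%g = 1.
Proof.
apply/lfunP => -[x s]; rewrite endo1 linearizeE /aff_lin /aff_trans /=.
by rewrite id_lfunE scaler0 addr0.
Qed.

Lemma linearizeX g n : linearize (g ^+ n)%g = linearize g ^+ n.
Proof.
elim: n => [|n IH]; first by rewrite expg0 linearize1.
by rewrite expgS exprS linearizeM IH.
Qed.

Lemma linearize_surj u (u' : E) : u' * u = 1 ->
  (forall w, (u w).2 = w.2) -> exists g, linearize g = u.
Proof.
move=> u'u u2.
have inj : (lker (affine_part u).2 == 0)%VS.
  apply/lker0P => x y; rewrite !affine_part2E => e.
  have : u (x, 0) = u (y, 0) :> homog V.
    by rewrite [LHS]surjective_pairing [RHS]surjective_pairing !u2 e.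
  by move=> /(congr1 u'); rewrite -!endoM u'u !endo1 => -[].
by exists (MkAff inj); exact: affine_partK.
Qed.

(** The geometric heart of the proof.  Such a p splits V as an H-invariant affine
    subspace times an invariant vector space; a cocompact group that is properly
    discontinuous on the former would have to contract the lines of the latter
    with finitely many elements. *)
Theorem vertical_projection_eq0 (H : set (Aff V)) (p : E) :
  is_subgroup H -> properly_discontinuous H -> cocompact H ->
  vertical_commutant (linearize @` H) p -> p * p = p -> p = 0.
Proof.
move=> sH pd [K cK HK] [p2 pH] pp.
pose a := (affine_part p).1; pose f := (affine_part p).2.
have pE k : p (k, 1) = (a + f k, 0).
  rewrite [LHS]surjective_pairing p2; congr (_, _).
  by rewrite /f affine_part2E /= [(k, 1)]homog_split linearD linearZ /= scale1r addrC.
(* (o, 1) is the component of (0, 1) in the kernel of p *)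
pose o : V := - a.
have po : p (o, 1) = 0.
  have -> : (o, 1) = (0, 1) - p (0, 1) :> homog V.
    by rewrite pE linear0 addr0; congr (_, _) => /=; rewrite ?sub0r ?subr0.
  by rewrite linearB /= -endoM pp subrr.
apply/lfunP => w; rewrite [RHS]lfunE /=.
pose v := (p w).1.
have vE : p w = (v, 0) by rewrite [LHS]surjective_pairing p2.
have pv : p (v, 0) = (v, 0) by rewrite -vE -endoM pp.
rewrite vE; congr (_, _); apply: contrapT => v0.
(* (q k, 1) is the component of (k, 1) in the kernel of p *)
pose q k : V := - a + (\1%VF - f) k.
pose C : set (vect_top V) := [set o] `|` (q @` K).
have cC : compact C.
  apply: compactU; first exact: compact_set1.
  apply: continuous_compact => //.
  exact/continuous_subspaceT/affine_continuous.
pose D : set (vect_top V) := \bigcup_(g in [set g | H g /\ (aff_act g @` C) `&` C !=set0])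
  ((fun k => aff_lin g a + (aff_lin g \o f)%VF k) @` K).
have [M DM] : exists M : R, forall x, D x -> `|vcoord x| <= M.
  apply: vect_top_compact_bounded; apply: finite_bigcup_compact; first exact: pd.
  move=> g; apply: continuous_compact => //.
  exact/continuous_subspaceT/affine_continuous.
have Dv t : D (t *: v).
  have [g Hg [k Kk xE]] := HK (o + t *: v).
  have gk : linearize g (k, 1) = (o + t *: v, 1) by rewrite linearize_act -xE.
  have pgk : linearize g (a + f k, 0) = (t *: v, 0).
    rewrite -pE -endoM -pH; last by exists g.
    have ov : (o + t *: v, 1) = (o, 1) + t *: (v, 0) :> homog V.
      by congr (_, _); rewrite /= scaler0 addr0.
    rewrite endoM gk ov linearD linearZ /= po pv add0r.
    by congr (_, _); rewrite /= scaler0.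
  have qk : aff_act g (q k) = o.
    have : linearize g (q k, 1) = (o, 1).
      have -> : (q k, 1) = (k, 1) - (a + f k, 0) :> homog V.
        congr (_, _); last by rewrite subr0.
        by rewrite /q add_lfunE opp_lfunE id_lfunE /= opprD addrCA.
      by rewrite linearB /= gk pgk; congr (_, _); rewrite /= ?subr0 // addrK.
    by rewrite linearize_act => -[].
  exists g; last first.
    exists k => //; move: pgk; rewrite linearizeE /= scale0r addr0 => -[<-].
    by rewrite comp_lfunE [RHS]linearD.
  split=> //; exists o; split; last by left.
  by exists (q k) => //; right; exists k.
have vn0 : 0 < `|vcoord v|.
  rewrite normr_gt0; apply/eqP => e0; apply: v0.
  by rewrite -(vcoordK v) e0 -(linear0 (@vcoord R V)) vcoordK.
have := DM _ (Dv ((M + 1) / `|vcoord v|)).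
rewrite linearZ normrZ normrM normfV normr_id divfK ?gt_eqF //.
apply/negP; rewrite -ltNge; apply: lt_le_trans (ler_norm _); by rewrite ltrDl.
Qed.

End Linearization.

Section ZariskiRoots.
Variables (R : realType) (V : vectType R).

(** The binomial coefficient of X over k. *)
Definition binpoly k : {poly R} := (k`!%:R)^-1 *: \prod_(j < k) ('X - j%:R%:P).

Lemma binpolyE k n : (binpoly k).[n%:R] = 'C(n, k)%:R.
Proof.
rewrite /binpoly hornerZ horner_prod.
have -> : \prod_(j < k) ('X - j%:R%:P).[n%:R] = (n ^_ k)%:R :> R.
  rewrite ffact_prod natr_prod.
  have [le_kn|lt_nk] := leqP k n.
    apply: eq_bigr => j _; rewrite !hornerE natrB //.
    by rewrite (leq_trans _ le_kn) // ltnW.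
  rewrite (bigD1 (Ordinal lt_nk)) //= [RHS](bigD1 (Ordinal lt_nk)) //=.
  by rewrite !hornerE subrr subnn !mul0r.
by rewrite -bin_ffact natrM mulrC mulfK // pnatr_eq0 -lt0n fact_gt0.
Qed.

Lemma nat_zeros_poly0 (q : {poly R}) m :
  (forall n : nat, q.[(m.+1 * n)%N%:R] = 0) -> q = 0.
Proof.
move=> q0; apply: (@roots_geq_poly_eq0 _ q [seq (m.+1 * n)%N%:R | n <- iota 0 (size q)]).
- by apply/allP => _ /mapP[n _ ->]; apply/rootP.
- rewrite map_inj_uniq ?iota_uniq // => x y /eqP.
  by rewrite eqr_nat eqn_pmul2l // => /eqP.
- by rewrite size_map size_iota.
Qed.

Lemma meval_horner n (p : mpoly.mpoly n R) (Q : 'I_n -> {poly R}) :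
  exists q : {poly R}, forall x, mpoly.meval (fun i => (Q i).[x]) p = q.[x].
Proof.
exists (\sum_(m <- mpoly.msupp p)
  (mpoly.mcoeff m p)%:P * \prod_i Q i ^+ (mpoly.fun_of_multinom m i)).
move=> x; rewrite mpoly.mevalE horner_sum; apply: eq_bigr => m _.
rewrite hornerM hornerC horner_prod; congr (_ * _).
by apply: eq_bigr => i _; rewrite horner_exp.
Qed.

Lemma unipotentX (v : endo V) N n : v ^+ N = 0 ->
  (1 + v) ^+ n = \sum_(k < N) 'C(n, k)%:R *: v ^+ k.
Proof.
move=> vN; have v0 k : (N <= k)%N -> v ^+ k = 0.
  by move=> /subnKC <-; rewrite exprD vN mul0r.
rewrite addrC exprD1n.
under eq_bigr do rewrite -scaler_nat.
rewrite -!(big_mkord predT (fun k => 'C(n, k)%:R *: v ^+ k)).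
have e a b (F : nat -> endo V) : (forall k, (a <= k)%N -> F k = 0) ->
    \sum_(0 <= k < a) F k = \sum_(0 <= k < a + b) F k.
  move=> F0; rewrite [RHS](big_cat_nat (n := a)) ?leq_addr //=.
  rewrite [X in _ + X]big_nat_cond [X in _ + X]big1 ?addr0 // => k.
  by move=> /andP[/andP[/F0]].
rewrite (e n.+1 N) => [|k lt_nk]; last by rewrite bin_small ?scale0r.
by rewrite addnC -(e N) // => k /v0 ->; rewrite scaler0.
Qed.

(** The powers of a unipotent element depend polynomially on the exponent, and a
    polynomial that vanishes at all multiples of m + 1 vanishes at 1. *)
Theorem zariski_closed_root (A : set (Aff V)) (w : Aff V) m N :
  is_subgroup A -> zariski_closed A -> (linearize w - 1) ^+ N = 0 ->
  A (w ^+ m.+1)%g -> A w.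
Proof.
move=> sA [P AE] wN Awm; pose v := linearize w - 1.
(* the coordinate i of w^n is the value at n of Q i *)
pose Q i : {poly R} := \sum_(k < N) vcoord (affine_part (v ^+ k)) ord0 i *: binpoly k.
have QE n i : (Q i).[n%:R] = aff_coord (w ^+ n)%g i.
  rewrite /aff_coord -[aff_val _]affine_endoK -/(linearize _) linearizeX.
  rewrite (_ : linearize w = 1 + v); last by rewrite addrC subrK.
  rewrite (unipotentX _ wN).
  rewrite linear_sum.
  rewrite linear_sum summxE.
  rewrite /Q horner_sum; apply: eq_bigr => k _.
  by rewrite hornerZ binpolyE !linearZ /= [RHS]mxE mulrC.
rewrite AE => p Pp.
have [q qE] := meval_horner p Q.
have q0 : q = 0.
  apply: (@nat_zeros_poly0 q m) => n; rewrite -qE.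
  have -> : (fun i => (Q i).[(m.+1 * n)%N%:R]) = aff_coord (w ^+ (m.+1 * n)%N)%g.
    by apply/funext => i; exact: QE.
  suff : A (w ^+ (m.+1 * n)%N)%g by rewrite AE; exact.
  rewrite expgnA; elim: n => [|n IH]; first by rewrite expg0; exact: is_subgroup1.
  by rewrite expgS; exact: is_subgroupM.
have -> : aff_coord w = (fun i => (Q i).[1%:R]).
  by apply/funext => i; rewrite QE expg1.
by rewrite qE q0 horner0.
Qed.

End ZariskiRoots.

(** * Centralizers and normalizers of crystallographic groups *)

Section Centralizer.
Variables (R : realType) (V : vectType R).
Variables (A H : set (Aff V)).
Hypotheses (sA : is_subgroup A) (cA : zariski_closed A).
Hypothesis crystH : affine_crystallographic H.

Let Hhat := @linearize R V @` H.
Let I := vertical_commutant Hhat.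

Definition centralizer_in : set (Aff V) :=
  [set z | A z /\ forall h, H h -> (h * z = z * h)%g].

Definition normalizer_in : set (Aff V) :=
  [set g | A g /\ forall h, H h -> H (g * h * g^-1)%g /\ H (g^-1 * h * g)%g].

Let Z := centralizer_in.
Let B := normalizer_in.

Lemma centralizer_in_subgroup : is_subgroup Z.
Proof.
split=> [|x y]; rewrite !inE.
  by split=> [|h _]; [exact: is_subgroup1|rewrite mulg1 mul1g].
move=> [Ax xH] [Ay yH]; split=> [|h Hh].
  by apply: is_subgroupM => //; exact: is_subgroupV.
have hy : (h * y^-1 = y^-1 * h)%g.
  by apply: (mulgI y); rewrite mulgA -yH // mulgK mulgA mulgV mul1g.
by rewrite mulgA xH // -mulgA hy mulgA.
Qed.

Lemma commutant_nilpotent (u : endo V) : I u -> exists k, u ^+ k = 0.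
Proof.
case: crystH => sH pdH /(cocompactP sH) ccH.
by apply: nil_of_no_projection => p Ip; exact: vertical_projection_eq0 Ip.
Qed.

Lemma centralizer_commutant z : Z z -> I (linearize z - 1).
Proof.
move=> [_ zH]; split=> [w|_ [h Hh <-]].
  by rewrite add_lfunE opp_lfunE endo1 linearizeE /= subrr.
by rewrite mulrBl mulrBr mul1r mulr1 -!linearizeM zH.
Qed.

Let Ialg : nonunital_subalgebra I := vertical_commutantP Hhat.

Lemma centralizer_root z m : Z z -> exists2 w, Z w & (w ^+ m.+1)%g = z.
Proof.
move=> Zz; have [Az zH] := Zz.
have [v Iv vz] := unipotent_root Ialg commutant_nilpotent m (centralizer_commutant Zz).
have [N vN] := commutant_nilpotent Iv.
rewrite [1 + (_ - 1)]addrC subrK in vz.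
have [w wE] : exists w, linearize w = 1 + v.
  apply: (@linearize_surj _ _ _ (linearize z^-1%g * (1 + v) ^+ m)) => [|w].
    by rewrite -mulrA -exprSr vz -linearizeM mulVg linearize1.
  by rewrite add_lfunE endo1 /=; case: Iv => -> _; rewrite addr0.
have wz : (w ^+ m.+1)%g = z by apply: linearize_inj; rewrite linearizeX wE.
exists w => //; split.
  apply: (@zariski_closed_root _ _ A w m N) => //; last by rewrite wz.
  by rewrite wE [1 + v]addrC addrK.
move=> h Hh; apply: linearize_inj; rewrite !linearizeM wE mulrDl mulrDr mul1r mulr1.
by case: Iv => _ ->//; exists h.
Qed.

Lemma normalizer_centralizer g z : B g -> Z z -> Z (g * z * g^-1)%g.
Proof.
move=> [Ag gH] [Az zH]; split.
  by do ![apply: is_subgroupM => //]; exact: is_subgroupV.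
move=> h Hh; have [_ Hg] := gH h Hh.
have hE : h = (g * (g^-1 * h * g) * g^-1)%g by rewrite !mulgA mulgV mul1g mulgK.
move: (g^-1 * h * g)%g Hg hE => k Hk ->; rewrite !mulgA !mulgVK.
by rewrite -(mulgA g k z) (zH _ Hk) mulgA.
Qed.

Lemma normalizerM g h : B g -> B h -> B (g * h)%g.
Proof.
move=> [Ag gH] [Ah hH]; split; first exact: is_subgroupM.
move=> k Hk; split.
  have [/gH[]] := hH k Hk.
  by rewrite invgM !mulgA.
have [_ /hH[_]] := gH k Hk.
by rewrite invgM !mulgA.
Qed.

Lemma centralizer_normalizer z : Z z -> B z.
Proof.
move=> [Az zH]; split=> // h Hh; split; first by rewrite -zH // mulgK.
by rewrite -mulgA zH // mulKg.
Qed.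

(** The filtration is canonical, so it is respected by all that normalizes H. *)
Lemma normalizer_filt g j a : B g -> depth_filt I j a ->
  depth_filt I j (linearize g * a * linearize g^-1%g).
Proof.
have stab k k' (u : endo V) : (k' * k = 1)%g -> (forall h, H h -> H (k' * h * k)%g) ->
    I u -> I (linearize k * u * linearize k').
  move=> k'k kH [u2 uH]; split=> [w|_ [h Hh <-]].
    by rewrite !endoM linearizeE /= u2.
  have hk : linearize k' * linearize h = linearize (k' * h * k)%g * linearize k'.
    rewrite -!linearizeM; congr linearize.
    by apply: (mulIg k); rewrite -!mulgA k'k mulg1.
  rewrite -mulrA hk mulrA -[_ * u * _]mulrA uH; last first.
    by exists (k' * h * k)%g => //; exact: kH.
  rewrite !mulrA -!linearizeM; congr (_ * _ * _); congr linearize.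
  have kk' : (k * k' = 1)%g by apply: (mulIg k); rewrite -mulgA k'k mulg1 mul1g.
  by rewrite !mulgA kk' mul1g.
move=> [_ gH]; apply: depth_filt_conj.
- by rewrite -linearizeM mulgV linearize1.
- by rewrite -linearizeM mulVg linearize1.
- by move=> u; apply: stab => [|h Hh]; [exact: mulVg|case: (gH h Hh)].
- by move=> u; apply: stab => [|h Hh]; [exact: mulgV|case: (gH h Hh)].
Qed.

End Centralizer.

(** * Extending representations to a finite extension *)

Section FiniteExtension.
Variables (Delta : groupType) (S : pred Delta) (Gamma : subGroupType S).
Hypothesis nS : normal_in S.
Local Open Scope group_scope.

Lemma subgroup_carrier1 : 1 \in S.
Proof. by have := valP (1 : Gamma); rewrite val1. Qed.

Lemma subgroup_carrierM x y : x \in S -> y \in S -> x * y \in S.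
Proof.
move=> Sx Sy.
by rewrite -[x](SubK Gamma Sx) -[y](SubK Gamma Sy) -valM; exact: valP.
Qed.

Lemma val_invg (x : Gamma) : val x^-1 = (val x)^-1.
Proof. by apply: (mulgI (val x)); rewrite -valM !mulgV val1. Qed.

Lemma subgroup_carrierV x : x \in S -> x^-1 \in S.
Proof.
by move=> Sx; rewrite -[x](SubK Gamma Sx) -val_invg; exact: valP.
Qed.

Lemma coset_classP x y :
  coset_class [set` S] x = coset_class [set` S] y <-> x^-1 * y \in S.
Proof.
split=> [/pi_fibre e|Sxy].
  have : [set y * s | s in [set` S]] y.
    by exists 1; [exact: subgroup_carrier1|rewrite mulg1].
  by rewrite -e => -[s Ss <-]; rewrite mulKg.
apply/pi_fibre/seteqP; split=> _ [s Ss <-].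
  exists (y^-1 * x * s); last by rewrite !mulgA mulgV mul1g.
  apply: subgroup_carrierM => //.
  by have := subgroup_carrierV Sxy; rewrite invgM invgK.
exists (x^-1 * y * s); last by rewrite !mulgA mulgV mul1g.
exact: subgroup_carrierM.
Qed.

(** The numbering [cls] of the cosets turns sums over F into sums over an
    ordinal; the last two clauses say that translations act on the numbers. *)
Lemma finite_cosets_enum : finite_set [set: cosets [set` S]] ->
  exists n (cls : Delta -> 'I_n.+1) (r : 'I_n.+1 -> Delta),
    [/\ cancel r cls, forall x y, cls x = cls y <-> x^-1 * y \in S,
      forall a x y, (cls (a * x) == cls (a * y)) = (cls x == cls y)
    & forall a x y, cls x = cls y -> cls (x * a) = cls (y * a)].
Proof.
move=> /finite_seqP[s0 sE]; pose s := undup s0.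
have sT q : q \in s by rewrite mem_undup; have : [set` s0] q by rewrite -sE.
pose q0 := coset_class [set` S] 1.
have sz : (size s).-1.+1 = size s.
  by apply: prednK; apply: leq_trans (_ : (index q0 s).+1 <= _)%N; rewrite ?index_mem.
pose cls x : 'I_(size s).-1.+1 := inord (index (coset_class [set` S] x) s).
have clsE x : cls x = index (coset_class [set` S] x) s :> nat.
  by rewrite inordK // sz index_mem.
have clsP x y : cls x = cls y <-> x^-1 * y \in S.
  rewrite -coset_classP; split=> [/(congr1 val) /=|e]; last by rewrite /cls e.
  by rewrite !clsE => /(congr1 (nth q0 s)); rewrite !nth_index.
exists (size s).-1, cls, (fun i => repr (nth q0 s i)); split=> // [i|a x y|a x y].
- apply: val_inj; rewrite /= clsE /coset_class reprK index_uniq ?undup_uniq //.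
  by have := ltn_ord i; rewrite [X in (_ < X)%N]sz.
- by apply/eqP/eqP => /clsP e; apply/clsP; move: e; rewrite invgM -mulgA mulKg.
- move=> /clsP/(nS a); rewrite conjgE => e; apply/clsP; move: e.
  by rewrite invgM !mulgA.
Qed.

End FiniteExtension.

Section Extension.
Variables (R : realType) (V : vectType R) (A : set (Aff V)).
Hypotheses (sA : is_subgroup A) (cA : zariski_closed A).
Variables (Delta : groupType) (S : pred Delta) (Gamma : subGroupType S).
Hypothesis nS : normal_in S.
Hypothesis finF : finite_set [set: cosets [set` S]].
Local Open Scope group_scope.
Local Notation conj := (conj_aut Gamma nS).

Lemma conjE x (c : Gamma) : val (conj x c) = x * val c * x^-1.
Proof. exact: val_conj_aut. Qed.

Lemma conjM x y c : conj (x * y) c = conj x (conj y c).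
Proof. by apply: val_inj; rewrite !conjE invgM !mulgA. Qed.

Lemma conj1 c : conj 1 c = c.
Proof. by apply: val_inj; rewrite conjE mul1g invg1 mulg1. Qed.

Lemma val_conjC x c : x * val c = val (conj x c) * x.
Proof. by rewrite conjE mulgVK. Qed.

Lemma carrier_val x y : x^-1 * y \in S -> exists c : Gamma, y = x * val c.
Proof.
by move=> Sxy; exists (insubd (1 : Gamma) (x^-1 * y)); rewrite insubdK ?mulVKg.
Qed.

Variable rho : Gamma -> Aff V.
Hypothesis rhoM : {morph rho : x y / x * y}.
Hypothesis rhoA : range rho `<=` A.
Hypothesis rhoC : affine_crystallographic (range rho).
Local Notation H := (range rho).
Local Notation Z := (centralizer_in A H).
Local Notation B := (normalizer_in A H).

Let normalizer_of (s : Delta -> Aff V) x : A (s x) ->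
  (forall y, A (s y)) ->
  (forall y c, s y * rho c * (s y)^-1 = rho (conj y c)) -> B (s x).
Proof.
move=> Ax As sP; split=> // _ [c _ <-]; split.
  by exists (conj x c) => //; rewrite sP.
exists (conj x^-1 c) => //.
have := sP x (conj x^-1 c); rewrite -conjM mulgV conj1 => <-.
by rewrite !mulgA mulVg mul1g mulgVK.
Qed.

(** The hypothesis says that conjugation by x fixes the class of rho.  The chosen
    a, made right equivariant under Gamma, is multiplicative up to Z, because
    both a (x y) and a x * a y induce conjugation by x y on rho. *)
Theorem extension_of_fixed :
  (forall x, exists2 a, A a & forall c, rho (conj x c) = a * rho c * a^-1) ->
  exists sigma : Delta -> Aff V, [/\ {morph sigma : x y / x * y},
    (forall c : Gamma, sigma (val c) = rho c) & forall x, A (sigma x)].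
Proof.
move=> fixed.
have /choice[a aE] : forall x, exists a,
    A a /\ forall c, rho (conj x c) = a * rho c * a^-1.
  by move=> x; have [a] := fixed x; exists a.
have Aa x : A (a x) by case: (aE x).
have aP x c : rho (conj x c) = a x * rho c * (a x)^-1 by case: (aE x).
have [n [cls [r [clsK clsP clsM clsMr]]]] := finite_cosets_enum Gamma nS finF.
have off x : (r (cls x))^-1 * x \in S by apply/clsP; rewrite clsK.
pose t x := insubd (1 : Gamma) ((r (cls x))^-1 * x).
have tE x : val (t x) = (r (cls x))^-1 * x by rewrite insubdK //; exact: off.
have xE x : x = r (cls x) * val (t x) by rewrite tE mulVKg.
(* s agrees with a on the representatives and is rho-equivariant on the right *)
pose s x := a (r (cls x)) * rho (t x).
have clsv x (c : Gamma) : cls (x * val c) = cls x.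
  by apply/esym/clsP; rewrite mulKg; exact: valP.
have sv x (c : Gamma) : s (x * val c) = s x * rho c.
  rewrite /s clsv -mulgA -rhoM; congr (_ * rho _).
  by apply: val_inj; rewrite valM !tE clsv mulgA.
have As x : A (s x).
  by apply: is_subgroupM => //; apply: rhoA; exists (t x).
have rhoV c : rho c^-1 = (rho c)^-1.
  have r1 : rho 1 = 1 by apply: (mulgI (rho 1)); rewrite -rhoM !mulg1.
  by apply: (mulgI (rho c)); rewrite -rhoM !mulgV.
have sP x c : s x * rho c * (s x)^-1 = rho (conj x c).
  have -> : s x * rho c * (s x)^-1 =
      a (r (cls x)) * (rho (t x) * rho c * rho (t x)^-1) * (a (r (cls x)))^-1.
    by rewrite /s invgM rhoV !mulgA.
  rewrite -!rhoM -aP; congr rho.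
  apply: val_inj; rewrite !conjE !valM val_invg.
  by rewrite tE invgM invgK !mulgA mulgV mul1g mulgK.
have sC x c : s x * rho c = rho (conj x c) * s x by rewrite -sP mulgVK.
clearbody s.
have Zs (z : Aff V) c : Z z -> rho c * z = z * rho c.
  by move=> [_]; apply; exists c.
have cv x y : cls x = cls y -> exists c : Gamma, y = x * val c.
  by move=> /clsP; exact: carrier_val.
have Ialg := vertical_commutantP (@linearize R V @` H).
have Inil := commutant_nilpotent rhoC.
have [d Jd] := depth_filt_sep Ialg Inil.
have Z_J z : Z z ->
    depth_filt (vertical_commutant (@linearize R V @` H)) 1 (linearize z - 1)%R.
  by move=> /centralizer_commutant; exact: depth_filt1.
have As0 : almost_hom (depth_filt (vertical_commutant (@linearize R V @` H)))
    (@linearize R V) Z cls B 0 s.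
  split.
  - by move=> x; exact: normalizer_of.
  - move=> x y z /cv[c ->] Zz; rewrite sv invgM -!mulgA; congr (_ * _).
    by rewrite !mulgA Zs // mulgK.
  - move=> x y b /cv[c ->]; split.
      by rewrite /defect mulgA !sv mulgA invgM !mulgA mulgK.
    pose c' := conj b^-1 c; have cE : c = conj b c' by rewrite -conjM mulgV conj1.
    have xb : x * val c * b = x * b * val c' by rewrite -!mulgA val_conjC -cE.
    rewrite /defect xb !sv -(mulgA (s x) (rho c)) cE -sC invgM.
    by rewrite !mulgA mulgK.
  - move=> x y; apply: level0 => //; split.
      by do ![apply: is_subgroupM => //]; exact: is_subgroupV.
    move=> _ [c _ <-]; pose c' := conj (x * y)^-1 c.
    have cE : c = conj (x * y) c' by rewrite -conjM mulgV conj1.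
    have e : rho c * s (x * y) = s (x * y) * rho c' by rewrite sC -cE.
    have {}e : (s (x * y))^-1 * rho c = rho c' * (s (x * y))^-1.
      by apply: (mulgI (s (x * y))); rewrite mulVKg mulgA -e mulgK.
    have e2 : s x * s y * rho c' = rho c * (s x * s y).
      by rewrite -mulgA sC mulgA sC -conjM -cE mulgA.
    by rewrite /defect -[RHS]mulgA e [RHS]mulgA e2 !mulgA.
have [h [hZ hcls] hM] := hom_lifting (depth_filtP _) (linearize1 V) (@linearizeM R V)
  (centralizer_in_subgroup H sA) Z_J (centralizer_root sA cA rhoC) clsK clsM clsMr
  (@centralizer_normalizer _ _ A H) (normalizerM sA) (normalizer_centralizer sA)
  (@normalizer_filt _ _ A H) (@linearize_inj R V) Jd As0.
exists (fun x => (h x)^-1 * s x); split=> // [c|x].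
  have s1 : (h 1)^-1 * s 1 = 1.
    by apply: (mulgI ((h 1)^-1 * s 1)); have /esym := hM 1 1; rewrite !mulg1.
  by rewrite -[val c]mul1g (hcls _ _ (clsv 1 c)) sv mulgA s1 mul1g.
apply: is_subgroupM => //; apply: is_subgroupV => //; by case: (hZ x).
Qed.

(** f g^-1 centralizes H, because f and g induce the same conjugations on it. *)
Theorem extension_unique (f g : Delta -> Aff V) :
  {morph f : x y / x * y} -> {morph g : x y / x * y} ->
  (forall x, A (f x)) -> (forall x, A (g x)) ->
  (forall c : Gamma, f (val c) = rho c) -> (forall c : Gamma, g (val c) = rho c) ->
  exists2 z, A z & forall x, g x = z * f x * z^-1.
Proof.
move=> fM gM fA gA fr gr.
have [n [cls [r [clsK clsP clsM clsMr]]]] := finite_cosets_enum Gamma nS finF.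
have homP s : {morph s : x y / x * y} -> (forall c : Gamma, s (val c) = rho c) ->
    forall x c, s x * rho c * (s x)^-1 = rho (conj x c).
  move=> sM sr x c; rewrite -!sr -sM val_conjC sM mulgK //.
have cv x y : cls x = cls y -> exists c : Gamma, y = x * val c.
  by move=> /clsP; exact: carrier_val.
have [d Jd] := depth_filt_sep (vertical_commutantP (@linearize R V @` H))
  (commutant_nilpotent rhoC).
have Z_J z : Z z ->
    depth_filt (vertical_commutant (@linearize R V @` H)) 1 (linearize z - 1)%R.
  by move=> /centralizer_commutant; exact: depth_filt1.
have fg : near_homs (depth_filt (vertical_commutant (@linearize R V @` H)))
    (@linearize R V) Z cls 0 f g.
  split=> // [x y /cv[c ->]|x].
    by rewrite fM gM fr gr invgM !mulgA mulgK.
  apply: level0 => //; split.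
    by apply: is_subgroupM => //; exact: is_subgroupV.
  move=> _ [c _ <-]; pose c' := conj x^-1 c.
  have cE : c = conj x c' by rewrite -conjM mulgV conj1.
  have fC : rho c * f x = f x * rho c' by rewrite cE -(homP f) // mulgVK.
  have gC : rho c * g x = g x * rho c' by rewrite cE -(homP g) // mulgVK.
  have {}gC : (g x)^-1 * rho c = rho c' * (g x)^-1.
    by apply: (mulgI (g x)); rewrite mulVKg mulgA -gC mulgK.
  by rewrite -[RHS]mulgA gC !mulgA fC.
have gZ x y z : cls x = cls y -> Z z -> g x * z * (g x)^-1 = g y * z * (g y)^-1.
  move=> /cv[c ->] [_ zH]; rewrite gM gr invgM -!mulgA; congr (_ * _).
  by rewrite !mulgA (zH (rho c)) ?mulgK //; exists c.
have [z [Az _] zE] := hom_conjugacy (depth_filtP _) (linearize1 V) (@linearizeM R V)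
  (centralizer_in_subgroup H sA) Z_J (centralizer_root sA cA rhoC) clsK clsM
  (normalizer_centralizer sA) (@normalizer_filt _ _ A H) (@linearize_inj R V) Jd gM
  (fun x => normalizer_of (gA x) gA (homP g gM gr)) gZ fg.
by exists z^-1; [exact: is_subgroupV|move=> x; rewrite zE invgK].
Qed.

End Extension.

(** * The restriction map *)

Section Restriction.
Variables (R : realType) (V : vectType R).
Variables (Delta : groupType) (S : pred Delta) (Gamma : subGroupType S).
Hypothesis nS : normal_in S.
Hypothesis finF : finite_set [set: cosets [set` S]].
Local Open Scope group_scope.

Lemma range_subgroup (G : groupType) (s : G -> Aff V) :
  {morph s : x y / x * y} -> is_subgroup (range s).
Proof.
move=> sM; split=> [|x y]; rewrite !inE.
  by exists 1 => //; apply: (mulgI (s 1)); rewrite -sM !mulg1.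
move=> [a _ <-] [b _ <-]; exists (a * b^-1) => //.
by apply: (mulIg (s b)); rewrite -sM !mulgVK.
Qed.

(** Gamma has finite index in Delta. *)
Lemma crystallographic_restriction (s : Delta -> Aff V) :
  {morph s : x y / x * y} ->
  affine_crystallographic (range (s \o (val : Gamma -> Delta))) <->
  affine_crystallographic (range s).
Proof.
move=> sM.
have [n [cls [r [clsK clsP _ _]]]] := finite_cosets_enum Gamma nS finF.
apply: (@crystallographic_finite_ext _ _ _ _ _ (s \o r)).
- by apply: range_subgroup => x y /=; rewrite valM sM.
- exact: range_subgroup.
- by move=> _ [c _ <-]; exists (val c).
- by move=> i; exists (r i).
move=> _ [x _ <-]; exists (cls x).
have /clsP/(@carrier_val _ _ Gamma)[c xE] : cls (r (cls x)) = cls x by rewrite clsK.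
by exists (s (val c)); [exists c|rewrite [in LHS]xE sM].
Qed.

Variable A : set (Aff V).

Lemma restriction_subproof (rho : Homc Delta A) :
  Homc Gamma A (val rho \o (val : Gamma -> Delta)).
Proof.
have [rM rI rA rC] : Homc Delta A (val rho) by exact: set_valP.
split.
- by move=> x y /=; rewrite valM rM.
- by move=> x y /rI/val_inj.
- by move=> _ [c _ <-]; apply: rA; exists (val c).
- exact/crystallographic_restriction.
Qed.

Definition restriction (rho : Homc Delta A) : Homc Gamma A :=
  SigSub (mem_set (restriction_subproof rho)).

Lemma continuous_ptws (X : topologicalType) (G : groupType)
    (h : X -> {ptws G -> Aff V}) :
  (forall c, continuous (fun x => h x c)) -> continuous h.
Proof.
move=> hc x.
have hF : Filter (h y @[y --> x]) by exact: fmap_filter.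
apply/(@cvg_sup _ _ (fun i : G => Topological.class (initial_topology
  (fun f : G -> Aff V => f i))) (h y @[y --> x]) (h x)) => c.
apply: (@continuous_comp_initial _ X (Aff V) (fun f : G -> Aff V => f c) h).
exact: hc.
Qed.

Lemma restriction_continuous : continuous restriction.
Proof.
apply: (@continuous_comp_initial _ _ {ptws Gamma -> Aff V}).
apply: continuous_ptws => c rho.
have c1 : continuous (val : Homc Delta A -> {ptws Delta -> Aff V}).
  exact: initial_continuous.
have c2 : continuous (fun f : {ptws Delta -> Aff V} => f (val c)).
  move=> f; exact: (@proj_continuous _ (fun=> Aff V) (val c) f).
exact: (continuous_comp (c1 rho) (c2 _)).
Qed.

Hypothesis sA : is_subgroup A.

Definition restriction_class (d : Dc Delta A) : Dc Gamma A :=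
  Dc_class (restriction (Dc_repr d)).

Lemma restriction_classE rho :
  restriction_class (Dc_class rho) = Dc_class (restriction rho).
Proof.
have : Dc_class (Dc_repr (Dc_class rho)) = Dc_class rho by rewrite /Dc_class reprK.
move=> /(Dc_classP _ _ sA)[a Aa e]; apply/(Dc_classP _ _ sA); exists a => //.
by rewrite /= e.
Qed.

Lemma restriction_fixed d : Dc_fixed Gamma nS A (restriction_class d).
Proof.
move=> q; rewrite /restriction_class; set rho := Dc_repr d.
have [rM _ rA _] : Homc Delta A (val rho) by exact: set_valP.
have qE : q = coset_class [set` S] (repr q) by rewrite /coset_class reprK.
rewrite qE betaE out_actE //; apply/(Dc_classP _ _ sA).
set x := repr q; exists (val rho x); first by apply: rA; exists x.
apply/funext => c /=.
have -> : val ((conj_aut Gamma nS x)^-1 c) = x^-1 * val c * x.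
  by rewrite -mulgA -conjgE; exact: val_conj_fun.
by rewrite -rM !mulgA mulgV mul1g rM mulgK.
Qed.

Definition restriction_to_fixed (d : Dc Delta A) : Dc_fixed Gamma nS A :=
  SigSub (mem_set (restriction_fixed d)).

Lemma restriction_to_fixed_continuous : continuous restriction_to_fixed.
Proof.
apply: (@continuous_comp_initial _ _ (Dc Gamma A)).
apply/quotient_continuous => rho.
rewrite (_ : _ \o _ = (@Dc_class _ _ Gamma A) \o restriction); last first.
  by apply/funext => s; exact: restriction_classE.
apply: continuous_comp; first exact: restriction_continuous.
exact: pi_continuous.
Qed.

Hypothesis cA : zariski_closed A.

Lemma restriction_class_inj : injective restriction_class.
Proof.
move=> d1 d2; rewrite -[d1]reprK -[d2]reprK.
move: (repr d1) (repr d2) => f g; rewrite -!/(Dc_class _) !restriction_classE.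
move=> /(Dc_classP _ _ sA)[a Aa /= e].
have [fM _ fA _] : Homc Delta A (val f) by exact: set_valP.
have [gM _ gA _] : Homc Delta A (val g) by exact: set_valP.
have [rM _ rA rC] : Homc Gamma A (val (restriction g)) by exact: set_valP.
have [z Az zE] : exists2 z, A z &
    forall x, val g x = z * (a * val f x * a^-1) * z^-1.
  apply: (@extension_unique _ _ A sA cA Delta S Gamma nS finF _ rC) => //.
  - by move=> x y /=; rewrite fM !mulgA mulgVK.
  - move=> x; do 2?[apply: is_subgroupM => //]; last exact: is_subgroupV.
    by apply: fA; exists x.
  - by move=> x; apply: gA; exists x.
  - by move=> c; move: (congr1 (@^~ c) e) => /= <-.
apply/(Dc_classP _ _ sA); exists (z * a); first exact: is_subgroupM.
by apply/funext => x; rewrite zE invgM !mulgA.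
Qed.

Hypothesis effective : injective (beta Gamma nS).

(** Effectiveness makes the extension injective: an element of its kernel
    commutes with Gamma up to the kernel of rho, so it centralizes Gamma and lies
    in it. *)
Lemma restriction_class_surj (d : Dc Gamma A) :
  Dc_fixed Gamma nS A d -> exists s, restriction_class s = d.
Proof.
rewrite -[d]reprK; move: (repr d) => rho; rewrite -/(Dc_class rho) => fixd.
have [rM rI rA rC] : Homc Gamma A (val rho) by exact: set_valP.
have [s [sM sr sAx]] : exists s : Delta -> Aff V, [/\ {morph s : x y / x * y},
    (forall c : Gamma, s (val c) = val rho c) & forall x, A (s x)].
  apply: (@extension_of_fixed _ _ A sA cA Delta S Gamma nS finF _ rM rA rC) => x.
  have := fixd (coset_class [set` S] x^-1); rewrite betaE out_actE //.
  move=> /esym/(Dc_classP _ _ sA)[a Aa /= e]; exists a => // c.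
  have /(congr1 (@^~ c)) /= <- := e.
  by congr (val rho _); apply: val_inj; rewrite val_conj_aut -[RHS]val_conj_fun.
have sE : val rho = s \o (val : Gamma -> Delta) :> (Gamma -> Aff V).
  by apply/funext => c /=; rewrite sr.
have s1 : s 1 = 1 by apply: (mulgI (s 1)); rewrite -sM !mulg1.
have sker k : s k = 1 -> k = 1.
  move=> sk; have skV : s k^-1 = 1.
    by apply: (mulgI (s k)); rewrite -sM mulgV s1 sk mulg1.
  have kC : conj_aut Gamma nS k = 1.
    apply: autP => c; apply: rI; rewrite -!sr val_conj_aut !sM sk skV.
    by rewrite mul1g mulg1.
  have : coset_class [set` S] 1 = coset_class [set` S] k.
    apply: effective; rewrite !betaE kC; congr out_of.
    by apply: autP => c; exact: conj1.
  move=> /(coset_classP Gamma)/(@carrier_val _ _ Gamma)[c].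
  rewrite mul1g => kE; rewrite kE.
  have -> : c = 1 by apply: rI; rewrite -!sr -kE sk val1 s1.
  exact: val1.
have sI : injective s.
  move=> x y xy; apply: (mulgI x^-1); rewrite mulVg; apply/esym/sker.
  by rewrite sM -xy -sM mulVg.
have sH : Homc Delta A s.
  split=> //; first by move=> _ [x _ <-].
  by apply: (crystallographic_restriction sM).1; move: rC; rewrite sE.
exists (Dc_class (SigSub (mem_set sH))); rewrite restriction_classE; congr Dc_class.
by apply: val_inj; rewrite /= sE.
Qed.

End Restriction.

(* Gamma is a subgroup of Delta, with carrier S and inclusion val. *)
Theorem corollary3p33 (R : realType) (V : vectType R) (A : set (Aff V))
    (A_subgroup : is_subgroup A) (A_closed : zariski_closed A)
    (A_transitive : transitive_on_V A)
    (Delta : groupType) (S : pred Delta) (Gamma : subGroupType S)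
    (Gamma_fg : finitely_generated Gamma) (Gamma_tf : torsionfree Gamma)
    (Gamma_nil : nilpotent_group Gamma)
    (Gamma_normal : normal_in S)
    (F_finite : finite_set [set: cosets [set` S]])
    (effective : injective (beta Gamma Gamma_normal)) :
  exists rbar : Dc Delta A -> Dc_fixed Gamma Gamma_normal A,
    [/\ forall rho : Homc Delta A, exists2 rho' : Homc Gamma A,
          (forall x : Gamma, val rho' x = val rho (val x))
          & val (rbar (Dc_class rho)) = Dc_class rho',
        continuous rbar
      & bijective rbar].
Proof.
exists (restriction_to_fixed Gamma Gamma_normal F_finite A_subgroup); split.
- move=> rho; exists (restriction Gamma Gamma_normal F_finite rho) => //.
  exact: restriction_classE.
- exact: restriction_to_fixed_continuous.
have rP (d : Dc_fixed Gamma Gamma_normal A) :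
    exists s, restriction_to_fixed Gamma Gamma_normal F_finite A_subgroup s = d.
  have [s sE] :=
    restriction_class_surj F_finite A_subgroup A_closed effective (set_valP d).
  by exists s; apply: val_inj.
have [inv invK] := choice rP; exists inv => // d.
apply: (restriction_class_inj (nS := Gamma_normal) (finF := F_finite)
  A_subgroup A_closed).
exact: (congr1 val (invK _)).
Qed.
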